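(* Let $k$ be a field, let $G$ be an abelian group, let $A$ be a $G$-graded $k$-algebra, and let $d$ be a dimension (a non-negative integer). Then $A$ is twisted Calabi--Yau of dimension $d$ if and only if $A$ is $G$-graded twisted Calabi--Yau of dimension $d$.
   Context: Conventions. $k$ is a field, $\otimes=\otimes_k$, modules are left modules unless stated otherwise, and all bimodules are $k$-central (scalars of $k$ act the same on both sides). $G$ is an abelian group, written multiplicatively. Enveloping algebra. $A^e = A\otimes A^{\mathrm{op}}$. An $(A,A)$-bimodule $M$ is viewed as a left or right $A^e$-module via $(a\otimes b^{\mathrm{op}})\cdot m = a\cdot m\cdot b = m\cdot(b\otimes a^{\mathrm{op}})$. The $(A,A)$-bimodule structure on $\mathrm{Ext}^i_{A^e}(A,A^e)$ (Ext of left $A^e$-modules) comes from the right $A^e$-module structure of $A^e$. Ungraded notions. $A$ is homologically smooth if $A$ has a finite-length resolution by finitely generated projective left $A^e$-modules. An $(A,A)$-bimodule $U$ is invertible if there is an $(A,A)$-bimodule $V$ with $U\otimes_A V\cong V\otimes_A U\cong A$ as $(A,A)$-bimodules. $A$ is twisted Calabi--Yau of dimension $d$ if $A$ is homologically smooth and there is an invertible $(A,A)$-bimodule $U$ such that, as $(A,A)$-bimodules, $\mathrm{Ext}^i_{A^e}(A,A^e)\cong 0$ for $i\ne d$ and $\mathrm{Ext}^d_{A^e}(A,A^e)\cong U$. Graded notions. A $G$-graded $k$-algebra is a $k$-algebra with a decomposition $A=\bigoplus_{\sigma\in G}A_\sigma$ into $k$-subspaces with $A_\tau A_\sigma\subseteq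 A_{\tau\sigma}$. A $G$-graded left module over a $G$-graded ring $R$ is $M=\bigoplus_{\sigma\in G} M_\sigma$ with $R_\tau M_\sigma\subseteq M_{\tau\sigma}$; morphisms in the category of $G$-graded $R$-modules are the degree-preserving $R$-linear maps. $A^e$ is $G$-graded with degree-$\gamma$ part spanned by the $a\otimes b^{\mathrm{op}}$ with $a\in A_\sigma$, $b\in A_\tau$, $\sigma\tau=\gamma$, and $G$-graded $(A,A)$-bimodules correspond to $G$-graded $A^e$-modules. $A$ is $G$-graded homologically smooth if, in the category of $G$-graded left $A^e$-modules, $A$ has a finite-length resolution by finitely generated projective objects. For $G$-graded $(A,A)$-bimodules $U,V$, the graded tensor product $U\,\underline{\otimes}_A V$ is $U\otimes_A V$ with degree-$\gamma$ component spanned by the $u\otimes v$ with $u\in U_\tau$, $v\in V_\sigma$, $\tau\sigma=\gamma$. A $G$-graded $(A,A)$-bimodule $U$ is $G$-graded invertible if there is a $G$-graded $(A,A)$-bimodule $V$ with $U\,\underline{\otimes}_A V\cong V\,\underline{\otimes}_A U\cong A$ as graded $(A,A)$-bimodules. For $G$-graded left $R$-modules $M,N$, a map $f\in\mathrm{Hom}_R(M,N)$ has degree $\tau$ if $f(M_\sigma)\subseteq N_{\sigma\tau}$ for all $\sigma\in G$; $\mathrm{Hom}_R(M,N)_\tau$ is the set of these, and $\underline{\mathrm{Hom}}_R(M,N)=\bigoplus_{\tau\in G}\mathrm{Hom}_R(M,N)_\tau$. Its right derived functors on the graded category are denoted $\underline{\mathrm{Ext}}^i_R(M,N)$. $A$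 is $G$-graded twisted Calabi--Yau of dimension $d$ if $A$ is $G$-graded homologically smooth and there is a $G$-graded invertible $(A,A)$-bimodule $U$ such that, as graded $(A,A)$-bimodules, $\underline{\mathrm{Ext}}^i_{A^e}(A,A^e)\cong 0$ for $i\neq d$ and $\underline{\mathrm{Ext}}^d_{A^e}(A,A^e)\cong U$. *)

(* Defs.v *)
From HB Require Import structures.
From mathcomp Require Import all_boot all_order all_algebra.
From mathcomp Require Import generic_quotient ring_quotient.
From mathcomp Require Import boolp classical_sets functions.

Set Implicit Arguments.
Unset Strict Implicit.
Unset Printing Implicit Defensive.

Import GRing.Theory.
Local Open Scope ring_scope.
Local Open Scope quotient_scope.
Local Open Scope classical_set_scope.

(* A k-algebra as a ring with a central structure map from k. The library's
   [algType k] only covers nonzero algebras; here A = 0 is allowed. *)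
Record kalgebra (k : fieldType) := Kalgebra {
  kalg_ring :> pzRingType;
  kalg_scal : {rmorphism k -> kalg_ring};
  kalg_scalC : forall c a, kalg_scal c * a = a * kalg_scal c }.

Definition finite_sums (T : zmodType) (S : set T) : set T :=
  [set x | exists s : seq T,
     (forall y, y \in s -> S y) /\ x = \sum_(y <- s) y].

(* M is the internal direct sum of the additive subgroups D sigma. *)
Record grading (G M : zmodType) (D : G -> set M) : Prop := Grading {
  grading0 : forall sigma, D sigma 0;
  gradingB : forall sigma x y, D sigma x -> D sigma y -> D sigma (x - y);
  grading_span : forall x, exists (s : seq G) (f : G -> M),
    (forall sigma, D sigma (f sigma)) /\ x = \sum_(sigma <- s) f sigma;
  grading_indep : forall (s : seq G) (f : G -> M),
    uniq s -> (forall sigma, D sigma (f sigma)) ->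
    \sum_(sigma <- s) f sigma = 0 -> forall sigma, sigma \in s -> f sigma = 0 }.

(* The grading group is an arbitrary abelian group, written additively as in
   the library. *)
Record graded_kalgebra (k : fieldType) (G : zmodType) := GradedKalgebra {
  galg :> kalgebra k;
  galg_deg : G -> set galg;
  galg_grading : grading galg_deg;
  galg_scal : forall sigma c a,
    galg_deg sigma a -> galg_deg sigma (kalg_scal galg c * a);
  galg_mul : forall tau sigma a b, galg_deg tau a -> galg_deg sigma b ->
    galg_deg (tau + sigma) (a * b) }.

(* The tensor product of a right S-module U and a left S-module V: finite
   formal sums of pairs, modulo the least congruence imposing commutativity,
   biadditivity and balancedness. Opposites then exist, by (0, v) = 0. *)
Section Tensor.
Variables (S : Type) (U V : zmodType) (ra : U -> S -> U) (la : S -> V -> V).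

Inductive tens_rel : seq (U * V) -> seq (U * V) -> Prop :=
| tens_refl s : tens_rel s s
| tens_sym s t : tens_rel s t -> tens_rel t s
| tens_trans t s r : tens_rel s t -> tens_rel t r -> tens_rel s r
| tens_cat s s' t t' :
    tens_rel s s' -> tens_rel t t' -> tens_rel (s ++ t) (s' ++ t')
| tens_comm s t : tens_rel (s ++ t) (t ++ s)
| tens_addl u u' v : tens_rel [:: (u + u', v)] [:: (u, v); (u', v)]
| tens_addr u v v' : tens_rel [:: (u, v + v')] [:: (u, v); (u, v')]
| tens_zero v : tens_rel [:: (0, v)] [::]
| tens_bal u c v : tens_rel [:: (ra u c, v)] [:: (u, la c v)].

Definition tens_relb (s t : seq (U * V)) : bool := `[< tens_rel s t >].

Lemma tens_relb_equiv : equiv_class_of tens_relb.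
Proof.
split=> [s|s t|t s r].
- exact/asboolP/tens_refl.
- by apply/asboolP/asboolP; apply: tens_sym.
- by move=> /asboolP h1 /asboolP h2; apply/asboolP/(tens_trans h1 h2).
Qed.

Canonical tens_equivr := EquivRelPack tens_relb_equiv.

Definition tensor : Type := {eq_quot tens_relb}.
HB.instance Definition _ : EqQuotient _ tens_relb tensor :=
  EqQuotient.on tensor.
HB.instance Definition _ := Choice.on tensor.

Definition tens_class (s : seq (U * V)) : tensor := \pi s.
Definition pure (u : U) (v : V) : tensor := tens_class [:: (u, v)].

Lemma tens_classP s t : tens_class s = tens_class t <-> tens_rel s t.
Proof.
split=> [h|h]; first exact/asboolP/(eqquotP tensor s t).
by apply/(eqquotP tensor s t)/asboolP.
Qed.

Lemma tens_class_ex (x : tensor) : exists s, x = tens_class s.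
Proof. by exists (repr x); rewrite /tens_class reprK. Qed.

Lemma tens_repr s : tens_rel (repr (tens_class s)) s.
Proof. by apply/tens_classP; rewrite /tens_class reprK. Qed.

Definition tens_neg (s : seq (U * V)) := [seq (- p.1, p.2) | p <- s].

Lemma tens_negK s : tens_rel (tens_neg s ++ s) [::].
Proof.
elim: s => [|[u v] s IHs] /=; first exact: tens_refl.
apply: (tens_trans (t := ([:: (- u, v)] ++ [:: (u, v)]) ++ (tens_neg s ++ s))).
  have -> : (- u, v) :: (tens_neg s ++ (u, v) :: s)
    = [:: (- u, v)] ++ ((tens_neg s ++ [:: (u, v)]) ++ s).
    by rewrite -catA.
  rewrite -(catA [:: _] [:: _]); apply: tens_cat; first exact: tens_refl.
  by rewrite catA; apply: tens_cat; [exact: tens_comm | exact: tens_refl].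
rewrite -[X in tens_rel _ X]cats0; apply: tens_cat => //.
apply: (tens_trans (tens_sym (tens_addl _ _ _))).
by rewrite addNr; apply: tens_zero.
Qed.

Definition tens_add (x y : tensor) := tens_class (repr x ++ repr y).
Definition tens_opp (x : tensor) := tens_class (tens_neg (repr x)).

Lemma tens_addE s t :
  tens_add (tens_class s) (tens_class t) = tens_class (s ++ t).
Proof. by apply/tens_classP/tens_cat; apply: tens_repr. Qed.

Lemma tens_addA : associative tens_add.
Proof.
move=> x y z; have [s ->] := tens_class_ex x.
have [t ->] := tens_class_ex y; have [r ->] := tens_class_ex z.
by rewrite !tens_addE catA.
Qed.

Lemma tens_addC : commutative tens_add.
Proof.
move=> x y; have [s ->] := tens_class_ex x; have [t ->] := tens_class_ex y.
by rewrite !tens_addE; apply/tens_classP/tens_comm.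
Qed.

Lemma tens_add0 : left_id (tens_class [::]) tens_add.
Proof. by move=> x; have [s ->] := tens_class_ex x; rewrite tens_addE. Qed.

Lemma tens_addN : left_inverse (tens_class [::]) tens_opp tens_add.
Proof.
move=> x; rewrite -[in X in tens_add _ X](reprK x) tens_addE.
exact/tens_classP/tens_negK.
Qed.

HB.instance Definition _ :=
  GRing.isZmodule.Build tensor tens_addA tens_addC tens_add0 tens_addN.

Lemma tens_classD s t : tens_class (s ++ t) = tens_class s + tens_class t.
Proof. by rewrite -tens_addE. Qed.

Lemma tens_class_sum s : tens_class s = \sum_(p <- s) pure p.1 p.2.
Proof.
elim: s => [|[u v] s IHs]; first by rewrite big_nil.
by rewrite big_cons -IHs -tens_classD.
Qed.

Lemma tens_ind (P : tensor -> Prop) :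
  P 0 -> (forall u v x, P x -> P (pure u v + x)) -> forall x, P x.
Proof.
move=> P0 PD x; have [s ->] := tens_class_ex x; rewrite tens_class_sum.
by elim: s => [|p s IHs]; rewrite ?big_nil // big_cons; apply: PD.
Qed.

Lemma pureDl v u u' : pure (u + u') v = pure u v + pure u' v.
Proof. by rewrite -tens_classD; apply/tens_classP/tens_addl. Qed.
Lemma pureDr u v v' : pure u (v + v') = pure u v + pure u v'.
Proof. by rewrite -tens_classD; apply/tens_classP/tens_addr. Qed.
Lemma pure_bal u c v : pure (ra u c) v = pure u (la c v).
Proof. exact/tens_classP/tens_bal. Qed.

Record balanced (W : zmodType) (f : U -> V -> W) : Prop := Balanced {
  balDl : forall v u u', f (u + u') v = f u v + f u' v;
  balDr : forall u v v', f u (v + v') = f u v + f u v';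
  bal_act : forall u c v, f (ra u c) v = f u (la c v) }.

Definition tens_lift (W : zmodType) (f : U -> V -> W) (x : tensor) : W :=
  \sum_(p <- repr x) f p.1 p.2.

Section Lift.
Variables (W : zmodType) (f : U -> V -> W).
Hypothesis fP : balanced f.

Lemma tens_rel_sum s t : tens_rel s t ->
  \sum_(p <- s) f p.1 p.2 = \sum_(p <- t) f p.1 p.2.
Proof.
elim=> {s t}.
- by [].
- by move=> s t _ ->.
- by move=> t s r _ -> _ ->.
- by move=> s s' t t' _ h1 _ h2; rewrite !big_cat /= h1 h2.
- by move=> s t; rewrite !big_cat /= addrC.
- by move=> u u' v; rewrite !big_cons !big_nil /= !addr0 (balDl fP).
- by move=> u v v'; rewrite !big_cons !big_nil /= !addr0 (balDr fP).
- move=> v; rewrite big_cons !big_nil /= addr0.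
  by apply: (addrI (f 0 v)); rewrite -(balDl fP) !addr0.
- by move=> u c v; rewrite !big_cons !big_nil /= (bal_act fP).
Qed.

Lemma tens_lift_class s : tens_lift f (tens_class s) = \sum_(p <- s) f p.1 p.2.
Proof. exact/tens_rel_sum/tens_repr. Qed.

Lemma tens_lift_pure u v : tens_lift f (pure u v) = f u v.
Proof. by rewrite tens_lift_class big_cons big_nil addr0. Qed.

Lemma tens_lift0 : tens_lift f 0 = 0.
Proof. by rewrite (tens_lift_class [::]) big_nil. Qed.

Lemma tens_liftD x y : tens_lift f (x + y) = tens_lift f x + tens_lift f y.
Proof.
have [s ->] := tens_class_ex x; have [t ->] := tens_class_ex y.
by rewrite -tens_classD !tens_lift_class big_cat.
Qed.
End Lift.

Lemma tens_lift_fD (W : zmodType) (f g : U -> V -> W) x :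
  tens_lift (fun u v => f u v + g u v) x = tens_lift f x + tens_lift g x.
Proof. exact: big_split. Qed.

Lemma eq_tens_lift (W : zmodType) (f g : U -> V -> W) x :
  (forall u v, f u v = g u v) -> tens_lift f x = tens_lift g x.
Proof. by move=> fg; apply: eq_bigr. Qed.

Lemma tens_ext (W : zmodType) (h1 h2 : tensor -> W) :
  {morph h1 : x y / x + y} -> {morph h2 : x y / x + y} ->
  (forall u v, h1 (pure u v) = h2 (pure u v)) -> forall x, h1 x = h2 x.
Proof.
have h0 (h : tensor -> W) : {morph h : x y / x + y} -> h 0 = 0.
  by move=> hD; apply: (addrI (h 0)); rewrite -hD !addr0.
move=> h1D h2D h12; elim/tens_ind=> [|u v x IHx]; first by rewrite !h0.
by rewrite h1D h2D h12 IHx.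
Qed.
End Tensor.
Arguments pure {S U V ra la}.

(* The enveloping algebra A (x)_k A^op; [pure a b] is a (x) b^op. *)
Section Enveloping.
Variables (k : fieldType) (A : kalgebra k).

Definition env : Type :=
  @tensor k A A (fun a c => a * kalg_scal A c) (fun c a => kalg_scal A c * a).
HB.instance Definition _ := GRing.Zmodule.on env.

Definition env_pure (a b : A) : env := pure a b.
Definition env_mul (x y : env) : env :=
  tens_lift (fun a b => tens_lift (fun c d => env_pure (a * c) (d * b)) y) x.
Definition env_one : env := env_pure 1 1.

Lemma env_pure_scal (a : A) c b :
  env_pure (a * kalg_scal A c) b = env_pure a (kalg_scal A c * b).
Proof. exact: pure_bal. Qed.

Lemma env_mul_bal2 (a b : A) :
  balanced (fun a c => a * kalg_scal A c) (fun c a => kalg_scal A c * a)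
    (fun c d => env_pure (a * c) (d * b)).
Proof.
split=> [v u u'|u v v'|u c v].
- by rewrite mulrDr [LHS]pureDl.
- by rewrite mulrDl [LHS]pureDr.
- by rewrite mulrA env_pure_scal mulrA.
Qed.

Lemma env_mul_bal1 (y : env) :
  balanced (fun a c => a * kalg_scal A c) (fun c a => kalg_scal A c * a)
    (fun a b => tens_lift (fun c d => env_pure (a * c) (d * b)) y).
Proof.
split=> [v u u'|u v v'|u c v].
- rewrite -tens_lift_fD; apply: eq_tens_lift => c d.
  by rewrite mulrDl [LHS]pureDl.
- rewrite -tens_lift_fD; apply: eq_tens_lift => c d.
  by rewrite mulrDr [LHS]pureDr.
- apply: eq_tens_lift => a b.
  by rewrite -mulrA kalg_scalC mulrA env_pure_scal !mulrA kalg_scalC.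
Qed.

Lemma env_mulE a b c d :
  env_mul (env_pure a b) (env_pure c d) = env_pure (a * c) (d * b).
Proof.
by rewrite /env_mul tens_lift_pure ?tens_lift_pure //;
  [exact: env_mul_bal2 | exact: env_mul_bal1].
Qed.

Lemma env_mulDl : left_distributive env_mul +%R.
Proof. by move=> x y z; rewrite /env_mul tens_liftD //; apply: env_mul_bal1. Qed.

Lemma env_mulDr : right_distributive env_mul +%R.
Proof.
move=> x y z; rewrite /env_mul -tens_lift_fD; apply: eq_tens_lift => a b.
by rewrite tens_liftD //; apply: env_mul_bal2.
Qed.

Lemma env_mulA : associative env_mul.
Proof.
move=> x y z; move: x; apply: tens_ext => [x x'|x x'|a b].
- by rewrite env_mulDl.
- by rewrite !env_mulDl.
move: y; apply: tens_ext => [y y'|y y'|c d].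
- by rewrite env_mulDl env_mulDr.
- by rewrite env_mulDr env_mulDl.
move: z; apply: tens_ext => [z z'|z z'|e f].
- by rewrite !env_mulDr.
- by rewrite !env_mulDr.
by rewrite -!/(env_pure _ _) !env_mulE !mulrA.
Qed.

Lemma env_mul1l : left_id env_one env_mul.
Proof.
apply: tens_ext => // [x y|a b]; first by rewrite env_mulDr.
by rewrite -!/(env_pure _ _) env_mulE mul1r mulr1.
Qed.

Lemma env_mul1r : right_id env_one env_mul.
Proof.
apply: tens_ext => // [x y|a b]; first by rewrite env_mulDl.
by rewrite -!/(env_pure _ _) env_mulE mul1r mulr1.
Qed.

HB.instance Definition _ := GRing.Zmodule_isPzRing.Build env
  env_mulA env_mul1l env_mul1r env_mulDl env_mulDr.

Lemma env_pureM a b c d :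
  env_pure a b * env_pure c d = env_pure (a * c) (d * b).
Proof. exact: env_mulE. Qed.
Lemma env_pureDl b a a' : env_pure (a + a') b = env_pure a b + env_pure a' b.
Proof. exact: pureDl. Qed.
Lemma env_pureDr a b b' : env_pure a (b + b') = env_pure a b + env_pure a b'.
Proof. exact: pureDr. Qed.
End Enveloping.

Record bimod (k : fieldType) (A : kalgebra k) := Bimod {
  bimod_car :> zmodType;
  lact : A -> bimod_car -> bimod_car;
  ract : bimod_car -> A -> bimod_car;
  lactDl : forall m a b, lact (a + b) m = lact a m + lact b m;
  lactDr : forall a m n, lact a (m + n) = lact a m + lact a n;
  lactA : forall a b m, lact a (lact b m) = lact (a * b) m;
  lact1 : forall m, lact 1 m = m;
  ractDl : forall a m n, ract (m + n) a = ract m a + ract n a;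
  ractDr : forall m a b, ract m (a + b) = ract m a + ract m b;
  ractA : forall a b m, ract (ract m a) b = ract m (a * b);
  ract1 : forall m, ract m 1 = m;
  lractA : forall a b m, ract (lact a m) b = lact a (ract m b);
  lract_central : forall c m, lact (kalg_scal A c) m = ract m (kalg_scal A c) }.

Section Bimodules.
Variables (k : fieldType) (A : kalgebra k).
Implicit Types U V M : bimod A.

Definition regular_bimod : bimod A.
Proof.
apply: (@Bimod k A A (fun a m => a * m) (fun m a => m * a)).
- by move=> *; rewrite mulrDl.
- by move=> *; rewrite mulrDr.
- by move=> *; rewrite mulrA.
- by move=> *; rewrite mul1r.
- by move=> *; rewrite mulrDl.
- by move=> *; rewrite mulrDr.
- by move=> *; rewrite mulrA.
- by move=> *; rewrite mulr1.
- by move=> *; rewrite mulrA.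
- by move=> *; rewrite kalg_scalC.
Defined.

Definition is_bimod_iso U V (f : U -> V) : Prop :=
  [/\ bijective f, {morph f : x y / x + y},
      forall a x, f (lact a x) = lact a (f x) &
      forall x a, f (ract x a) = ract (f x) a].

Definition bimod_iso U V : Prop := exists f : U -> V, is_bimod_iso f.

Definition bimod_zero U : Prop := forall x : U, x = 0.

Section TensorBimod.
Variables U V : bimod A.

Definition tens_car : zmodType := @tensor A U V (@ract k A U) (@lact k A V).
Definition tpure (u : U) (v : V) : tens_car := pure u v.
Definition tens_lact (a : A) (x : tens_car) : tens_car :=
  tens_lift (fun u v => tpure (lact a u) v) x.
Definition tens_ract (x : tens_car) (a : A) : tens_car :=
  tens_lift (fun u v => tpure u (ract v a)) x.

Lemma tens_lact_bal a :
  balanced (@ract k A U) (@lact k A V) (fun u v => tpure (lact a u) v).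
Proof.
split=> [v u u'|u v v'|u c v].
- by rewrite lactDr [LHS]pureDl.
- by rewrite [LHS]pureDr.
- by rewrite -lractA [LHS]pure_bal.
Qed.

Lemma tens_ract_bal a :
  balanced (@ract k A U) (@lact k A V) (fun u v => tpure u (ract v a)).
Proof.
split=> [v u u'|u v v'|u c v].
- by rewrite [LHS]pureDl.
- by rewrite ractDl [LHS]pureDr.
- by rewrite lractA [LHS]pure_bal.
Qed.

Lemma tens_lactD a : {morph tens_lact a : x y / x + y}.
Proof. by move=> x y; rewrite [LHS]tens_liftD //; apply: tens_lact_bal. Qed.
Lemma tens_ractD a : {morph tens_ract^~ a : x y / x + y}.
Proof. by move=> x y; rewrite [LHS]tens_liftD //; apply: tens_ract_bal. Qed.
Lemma tens_lactE a u v : tens_lact a (pure u v) = tpure (lact a u) v.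
Proof. by rewrite /tens_lact tens_lift_pure //; apply: tens_lact_bal. Qed.
Lemma tens_ractE a u v : tens_ract (pure u v) a = tpure u (ract v a).
Proof. by rewrite /tens_ract tens_lift_pure //; apply: tens_ract_bal. Qed.

Definition tensor_bimod : bimod A.
Proof.
apply: (@Bimod k A tens_car tens_lact tens_ract).
- move=> m a b; rewrite /tens_lact -tens_lift_fD; apply: eq_tens_lift => u v.
  by rewrite lactDl [LHS]pureDl.
- exact: tens_lactD.
- move=> a b; apply: tens_ext => [x y|x y|u v]; rewrite ?tens_lactD //.
  by rewrite !tens_lactE lactA.
- apply: tens_ext => [x y|x y|u v]; rewrite ?tens_lactD //.
  by rewrite tens_lactE lact1.
- exact: tens_ractD.
- move=> m a b; rewrite /tens_ract -tens_lift_fD; apply: eq_tens_lift => u v.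
  by rewrite ractDr [LHS]pureDr.
- move=> a b; apply: tens_ext => [x y|x y|u v]; rewrite ?tens_ractD //.
  by rewrite !tens_ractE ractA.
- apply: tens_ext => [x y|x y|u v]; rewrite ?tens_ractD //.
  by rewrite tens_ractE ract1.
- move=> a b; apply: tens_ext => [x y|x y|u v];
    rewrite ?(tens_lactD, tens_ractD) //.
  by rewrite tens_lactE !tens_ractE tens_lactE.
- move=> c; apply: tens_ext => [x y|x y|u v];
    rewrite ?(tens_lactD, tens_ractD) //.
  by rewrite tens_lactE tens_ractE -[ract v _]lract_central
    -[RHS]pure_bal lract_central.
Defined.
End TensorBimod.

Definition invertible_bimod U : Prop := exists V : bimod A,
  bimod_iso (tensor_bimod U V) regular_bimod /\
  bimod_iso (tensor_bimod V U) regular_bimod.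

(* A bimodule as a left A^e-module: (a (x) b^op) . m = a m b. *)
Section EnvModule.
Variable M : bimod A.

Definition env_mod_car : Type := M.
HB.instance Definition _ := GRing.Zmodule.on env_mod_car.

Definition env_scale (x : env A) (m : env_mod_car) : env_mod_car :=
  tens_lift (fun a b => lact a (ract (m : M) b)) x.

Lemma env_scale_bal (m : M) :
  balanced (fun a c => a * kalg_scal A c) (fun c a => kalg_scal A c * a)
    (fun a b => lact a (ract m b)).
Proof.
split=> [v u u'|u v v'|u c v].
- by rewrite lactDl.
- by rewrite ractDr lactDr.
- by rewrite -lactA -lractA lract_central ractA.
Qed.

Lemma env_scalePure a b m :
  env_scale (env_pure a b) m = lact a (ract (m : M) b).
Proof. by rewrite /env_scale tens_lift_pure //; apply: env_scale_bal. Qed.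

Lemma env_scaleDl m : {morph env_scale^~ m : x y / x + y}.
Proof. by move=> x y; rewrite [LHS]tens_liftD //; apply: env_scale_bal. Qed.

Lemma env_scaleDr : right_distributive env_scale +%R.
Proof.
move=> x m n; rewrite /env_scale -tens_lift_fD; apply: eq_tens_lift => a b.
by rewrite ractDl lactDr.
Qed.

Lemma env_scale1 : left_id 1 env_scale.
Proof. by move=> m; rewrite env_scalePure ract1 lact1. Qed.

Lemma env_scaleA x y m : env_scale x (env_scale y m) = env_scale (x * y) m.
Proof.
move: x; apply: tens_ext => [x x'|x x'|a b].
- by rewrite env_scaleDl.
- by rewrite mulrDl env_scaleDl.
move: y; apply: tens_ext => [y y'|y y'|c d].
- by rewrite env_scaleDl env_scaleDr.
- by rewrite mulrDr env_scaleDl.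
rewrite -!/(env_pure _ _) env_pureM !env_scalePure.
by rewrite lractA ractA lactA.
Qed.

HB.instance Definition _ := GRing.Zmodule_isLmodule.Build (env A) env_mod_car
  env_scaleA env_scale1 env_scaleDr env_scaleDl.

Definition env_mod : lmodType (env A) := env_mod_car.
End EnvModule.

Record subbimod (X : bimod A) := Subbimod {
  sb_set : set X;
  sb0 : sb_set 0;
  sbB : forall x y, sb_set x -> sb_set y -> sb_set (x - y);
  sb_lact : forall a x, sb_set x -> sb_set (lact a x);
  sb_ract : forall x a, sb_set x -> sb_set (ract x a) }.

Section SubQuot.
Variables (X : bimod A) (Z : subbimod X).

Definition sb_pred : {pred X} := fun x => `[< sb_set Z x >].

Lemma sb_predP x : reflect (sb_set Z x) (x \in sb_pred).
Proof. exact: asboolP. Qed.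

Lemma sb_zmod_closed : zmod_closed sb_pred.
Proof.
split; first exact/sb_predP/sb0.
by move=> x y /sb_predP hx /sb_predP hy; apply/sb_predP/sbB.
Qed.

HB.instance Definition _ := GRing.isZmodClosed.Build X sb_pred sb_zmod_closed.

Record sub_car := SubCar { sub_val : X; _ : sub_val \in sb_pred }.
HB.instance Definition _ := [isSub for sub_val].
HB.instance Definition _ := [Choice of sub_car by <:].
HB.instance Definition _ := [SubChoice_isSubZmodule of sub_car by <:].

Lemma sub_valP (x : sub_car) : sb_set Z (sub_val x).
Proof. by apply/sb_predP; case: x. Qed.

Definition sub_mk (x : X) (h : sb_set Z x) : sub_car :=
  SubCar (introT (sb_predP x) h).

Definition sub_bimod : bimod A.
Proof.
apply: (@Bimod k A sub_car (fun a x => sub_mk (sb_lact a (sub_valP x)))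
                           (fun x a => sub_mk (sb_ract a (sub_valP x)))).
- by move=> m a b; apply/val_inj; rewrite /= lactDl.
- by move=> a m n; apply/val_inj; rewrite /= lactDr.
- by move=> a b m; apply/val_inj; rewrite /= lactA.
- by move=> m; apply/val_inj; rewrite /= lact1.
- by move=> a m n; apply/val_inj; rewrite /= ractDl.
- by move=> m a b; apply/val_inj; rewrite /= ractDr.
- by move=> a b m; apply/val_inj; rewrite /= ractA.
- by move=> m; apply/val_inj; rewrite /= ract1.
- by move=> a b m; apply/val_inj; rewrite /= lractA.
- by move=> c m; apply/val_inj; rewrite /= lract_central.
Defined.

Definition quot_car : zmodType := {ideal_quot sb_pred}.
Definition quot_class (x : X) : quot_car := \pi_{ideal_quot sb_pred} x.

Lemma quot_classP x y : quot_class x = quot_class y <-> sb_set Z (x - y).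
Proof.
split=> [h|/sb_predP h]; last by apply/eqP; rewrite -Quotient.idealrBE.
by apply/sb_predP; rewrite Quotient.idealrBE; apply/eqP.
Qed.

Lemma quot_classD : {morph quot_class : x y / x + y}.
Proof. by move=> x y; rewrite /quot_class raddfD. Qed.

Lemma quot_class_ex (q : quot_car) : exists x, q = quot_class x.
Proof. by exists (repr q); rewrite /quot_class reprK. Qed.

Definition quot_lact a (q : quot_car) := quot_class (lact a (repr q)).
Definition quot_ract (q : quot_car) a := quot_class (ract (repr q) a).

Lemma quot_repr x : sb_set Z (repr (quot_class x) - x).
Proof. by apply/quot_classP; rewrite /quot_class reprK. Qed.

Lemma bimod_lactB (a : A) (x y : X) : lact a x - lact a y = lact a (x - y).
Proof. by apply/eqP; rewrite subr_eq -lactDr subrK. Qed.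
Lemma bimod_ractB (a : A) (x y : X) : ract x a - ract y a = ract (x - y) a.
Proof. by apply/eqP; rewrite subr_eq -ractDl subrK. Qed.

Lemma quot_lactE a x : quot_lact a (quot_class x) = quot_class (lact a x).
Proof. by apply/quot_classP; rewrite bimod_lactB; apply/sb_lact/quot_repr. Qed.
Lemma quot_ractE a x : quot_ract (quot_class x) a = quot_class (ract x a).
Proof. by apply/quot_classP; rewrite bimod_ractB; apply/sb_ract/quot_repr. Qed.

Definition quot_bimod : bimod A.
Proof.
apply: (@Bimod k A quot_car quot_lact quot_ract).
- move=> q a b; have [x ->] := quot_class_ex q.
  by rewrite !quot_lactE lactDl quot_classD.
- move=> a q r; have [x ->] := quot_class_ex q; have [y ->] := quot_class_ex r.
  by rewrite -quot_classD !quot_lactE lactDr quot_classD.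
- move=> a b q; have [x ->] := quot_class_ex q.
  by rewrite !quot_lactE lactA.
- by move=> q; have [x ->] := quot_class_ex q; rewrite quot_lactE lact1.
- move=> a q r; have [x ->] := quot_class_ex q; have [y ->] := quot_class_ex r.
  by rewrite -quot_classD !quot_ractE ractDl quot_classD.
- move=> q a b; have [x ->] := quot_class_ex q.
  by rewrite !quot_ractE ractDr quot_classD.
- move=> a b q; have [x ->] := quot_class_ex q.
  by rewrite !quot_ractE ractA.
- by move=> q; have [x ->] := quot_class_ex q; rewrite quot_ractE ract1.
- move=> a b q; have [x ->] := quot_class_ex q.
  by rewrite quot_lactE !quot_ractE quot_lactE lractA.
- move=> c q; have [x ->] := quot_class_ex q.
  by rewrite quot_lactE quot_ractE lract_central.
Defined.
End SubQuot.

Section Subquotient.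
Variables (X : bimod A) (Z B : subbimod X).

Definition sub_restrict : subbimod (sub_bimod Z).
Proof.
apply: (@Subbimod (sub_bimod Z) [set x | sb_set B (sub_val x)]).
- exact: sb0.
- by move=> x y; apply: sbB.
- by move=> a x; apply: sb_lact.
- by move=> x a; apply: sb_ract.
Defined.

(* Z / (B cap Z), used for coboundaries B contained in the cocycles Z *)
Definition subquot : bimod A := quot_bimod sub_restrict.
Definition subquot_class (z : sub_bimod Z) : subquot := quot_class sub_restrict z.
End Subquotient.

(* Maps P -> A^e with the bimodule structure induced by the right
   A^e-module structure of A^e, where m . (b (x) a^op) = a m b. *)
Definition fun_bimod (P : zmodType) : bimod A.
Proof.
apply: (@Bimod k A (P -> env A) (fun a f p => f p * env_pure 1 a)
                                (fun f b p => f p * env_pure b 1)).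
- by move=> f a b; apply/funext => p; rewrite env_pureDr mulrDr.
- by move=> a f g; apply/funext => p; rewrite mulrDl.
- by move=> a b f; apply/funext => p; rewrite -mulrA env_pureM mulr1.
- by move=> f; apply/funext => p; rewrite mulr1.
- by move=> b f g; apply/funext => p; rewrite mulrDl.
- by move=> f a b; apply/funext => p; rewrite env_pureDl mulrDr.
- by move=> a b f; apply/funext => p; rewrite -mulrA env_pureM mulr1.
- by move=> f; apply/funext => p; rewrite mulr1.
- by move=> a b f; apply/funext => p;
    rewrite -!mulrA !env_pureM !mulr1 !mul1r.
- move=> c f; apply/funext => p; congr (_ * _).
  by rewrite -{1}[kalg_scal A c]mulr1 -env_pure_scal mul1r.
Defined.
End Bimodules.

Section Resolutions.
Variable R : pzRingType.

Definition surjective (S T : Type) (f : S -> T) := forall y, exists x, f x = y.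

Definition exact_at (U V W : zmodType) (f : U -> V) (g : V -> W) :=
  forall y, g y = 0 <-> exists x, f x = y.

Definition projective (P : lmodType R) : Prop :=
  forall (M N : lmodType R) (f : {linear M -> N}) (g : {linear P -> N}),
    surjective f -> exists h : {linear P -> M}, forall x, f (h x) = g x.

Definition finitely_generated (M : lmodType R) : Prop :=
  exists s : seq M, forall m, exists c : 'I_(size s) -> R,
    m = \sum_i c i *: s`_i.

Record resolution (M : lmodType R) := Resolution {
  res_mod :> nat -> lmodType R;
  res_diff : forall n, {linear res_mod n.+1 -> res_mod n};
  res_aug : {linear res_mod 0%N -> M};
  res_aug_surj : surjective res_aug;
  res_exact0 : exact_at (res_diff 0%N) res_aug;
  res_exactS : forall n, exact_at (res_diff n.+1) (res_diff n) }.

Definition finite_length (P : nat -> lmodType R) : Prop :=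
  exists n : nat, forall i, (n < i)%N -> forall x : P i, x = 0.
End Resolutions.

Section GradedModules.
Variables (G : zmodType) (R : pzRingType) (Rdeg : G -> set R).

Record grmod := Grmod {
  grmod_car :> lmodType R;
  grmod_deg : G -> set grmod_car;
  grmod_grading : grading grmod_deg;
  grmod_scale : forall tau sigma r m, Rdeg tau r -> grmod_deg sigma m ->
    grmod_deg (tau + sigma) (r *: m) }.

Definition degree_preserving (M N : grmod) (f : M -> N) : Prop :=
  forall sigma m, grmod_deg sigma m -> grmod_deg sigma (f m).

(* Projective objects of the category of graded modules, whose epimorphisms
   are the surjective degree-preserving linear maps. *)
Definition gr_projective (P : grmod) : Prop :=
  forall (M N : grmod) (f : {linear M -> N}) (g : {linear P -> N}),
    degree_preserving f -> degree_preserving g -> surjective f ->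
    exists2 h : {linear P -> M}, degree_preserving h & forall x, f (h x) = g x.

Record gr_resolution (M : grmod) := GrResolution {
  gres_mod :> nat -> grmod;
  gres_diff : forall n, {linear gres_mod n.+1 -> gres_mod n};
  gres_aug : {linear gres_mod 0%N -> M};
  gres_diff_deg : forall n, degree_preserving (gres_diff n);
  gres_aug_deg : degree_preserving gres_aug;
  gres_aug_surj : surjective gres_aug;
  gres_exact0 : exact_at (gres_diff 0%N) gres_aug;
  gres_exactS : forall n, exact_at (gres_diff n.+1) (gres_diff n) }.
End GradedModules.

Section Ext.
Variables (k : fieldType) (A : kalgebra k).

Definition is_hom (P : lmodType (env A)) (f : P -> env A) : Prop :=
  (forall x y, f (x + y) = f x + f y) /\ (forall r x, f (r *: x) = r * f x).

Section Cohomology.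
Variables (P : nat -> lmodType (env A)).
Variable d : forall n, {linear P n.+1 -> P n}.

Definition cocycle (i : nat) : set (fun_bimod A (P i)) :=
  [set f | is_hom f /\ forall x, f (d i x) = 0].

Definition coboundary (i : nat) : set (fun_bimod A (P i)) :=
  match i with
  | 0 => [set f | f = 0]
  | j.+1 => [set f | exists2 g : P j -> env A, is_hom g &
                       f = fun x => g (d j x)]
  end.

Lemma is_hom0 (Q : lmodType (env A)) : @is_hom Q (0 : fun_bimod A Q).
Proof. by split=> [x y|r x]; rewrite /= ?addr0 ?mulr0. Qed.
Lemma is_homB (Q : lmodType (env A)) (f g : fun_bimod A Q) :
  is_hom f -> is_hom g -> @is_hom Q (f - g).
Proof.
move=> [fD fZ] [gD gZ]; split=> [x y|r x].
  by rewrite -![(f - g) _]/(f _ - g _) fD gD opprD addrACA.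
by rewrite -![(f - g) _]/(f _ - g _) fZ gZ mulrBr.
Qed.
Lemma is_homM (Q : lmodType (env A)) (f : Q -> env A) (y : env A) :
  is_hom f -> @is_hom Q (fun x => f x * y).
Proof.
by move=> [fD fZ]; split=> [x z|r x]; rewrite ?fD ?fZ ?mulrDl ?mulrA.
Qed.

Definition cocycles (i : nat) : subbimod (fun_bimod A (P i)).
Proof.
apply: (@Subbimod k A _ (@cocycle i)).
- by split=> //; apply: is_hom0.
- move=> f g [fL fd] [gL gd]; split; first exact: is_homB.
  by move=> x; rewrite -![(f - g) _]/(f _ - g _) fd gd subr0.
- move=> a f [fL fd]; split; first exact: is_homM.
  by move=> x; rewrite /= fd mul0r.
- move=> f a [fL fd]; split; first exact: is_homM.
  by move=> x; rewrite /= fd mul0r.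
Defined.

Definition coboundaries (i : nat) : subbimod (fun_bimod A (P i)).
Proof.
apply: (@Subbimod k A _ (@coboundary i)); case: i => [|j] /=.
- by [].
- by exists 0 => //; apply: is_hom0.
- by move=> f g -> ->; rewrite subr0.
- move=> f g [f' f'L ->] [g' g'L ->]; exists ((f' : fun_bimod A _) - g') => //.
  exact: is_homB.
- by move=> a f ->; apply/funext => x; rewrite /= mul0r.
- move=> a f [f' f'L ->]; exists (fun x => f' x * env_pure 1 a) => //.
  exact: is_homM.
- by move=> f a ->; apply/funext => x; rewrite /= mul0r.
- move=> f a [f' f'L ->]; exists (fun x => f' x * env_pure a 1) => //.
  exact: is_homM.
Defined.

(* The i-th cohomology of Hom_{A^e}(P, A^e). When P is a projective
   resolution of M this is Ext^i_{A^e}(M, A^e), as an (A,A)-bimodule. *)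
Definition cohomology (i : nat) : bimod A :=
  subquot (cocycles i) (coboundaries i).
End Cohomology.

Definition Ext (M : lmodType (env A)) (P : resolution M) (i : nat) : bimod A :=
  cohomology (@res_diff _ _ P) i.

Definition homologically_smooth : Prop :=
  exists P : resolution (env_mod (regular_bimod A)),
    (forall i, projective (P i) /\ finitely_generated (P i)) /\
    finite_length P.

(* Ext is independent of the projective resolution up to isomorphism, so the
   conditions on it are imposed on all of them; the first conjunct ensures
   that there is one. *)
Definition twisted_CY (d : nat) : Prop :=
  homologically_smooth /\
  exists U : bimod A, invertible_bimod U /\
    forall P : resolution (env_mod (regular_bimod A)),
      (forall i, projective (P i)) ->
      (forall i, i <> d -> bimod_zero (Ext P i)) /\ bimod_iso (Ext P d) U.
End Ext.

Section Graded.
Variables (k : fieldType) (G : zmodType) (A : graded_kalgebra k G).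

(* The set of the homogeneous a (x) b^op of degree gamma is stable under
   scalars, so its finite sums are its k-linear span. *)
Definition env_deg (gamma : G) : set (env A) :=
  finite_sums [set x | exists sigma tau a b,
    [/\ galg_deg sigma a, galg_deg tau b, sigma + tau = gamma &
        x = env_pure a b]].

Record grbimod := Grbimod {
  grbimod_car :> bimod A;
  grbimod_deg : G -> set grbimod_car;
  grbimod_grading : grading grbimod_deg;
  grbimod_lact : forall tau sigma (a : A) m, galg_deg tau a ->
    grbimod_deg sigma m -> grbimod_deg (tau + sigma) (lact a m);
  grbimod_ract : forall sigma tau m (a : A), grbimod_deg sigma m ->
    galg_deg tau a -> grbimod_deg (sigma + tau) (ract m a) }.

Definition gr_regular_bimod : grbimod :=
  @Grbimod (regular_bimod A) (@galg_deg k G A)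
    (galg_grading A) (@galg_mul k G A) (@galg_mul k G A).

Lemma finite_sumsP (T : zmodType) (S : set T) (D : set T) :
  D 0 -> (forall x y, D x -> D y -> D (x + y)) -> (forall x, S x -> D x) ->
  forall x, finite_sums S x -> D x.
Proof.
move=> D0 DD SD x [s [sS ->]]; elim: s sS => [|y s IHs] sS.
  by rewrite big_nil.
rewrite big_cons; apply: DD; first by apply/SD/sS; rewrite mem_head.
by apply: IHs => z zs; apply: sS; rewrite inE zs orbT.
Qed.

Lemma gradingD (M : zmodType) (D : G -> set M) : grading D ->
  forall sigma x y, D sigma x -> D sigma y -> D sigma (x + y).
Proof.
move=> gD sigma x y Dx Dy; rewrite -[y]opprK -[- y]sub0r.
by apply: (gradingB gD) => //; apply: (gradingB gD) => //; apply: grading0.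
Qed.

Lemma env_mod_deg_scale (M : grbimod) tau sigma (r : env A) (m : env_mod M) :
  env_deg tau r -> @grbimod_deg M sigma m ->
  @grbimod_deg M (tau + sigma) (r *: m : env_mod M).
Proof.
move=> hr hm; move: r hr.
apply: (finite_sumsP (D := fun r : env A =>
  @grbimod_deg M (tau + sigma) (r *: m : env_mod M))).
- by rewrite scale0r; apply: (grading0 (grbimod_grading M)).
- move=> x y hx hy; rewrite scalerDl.
  exact: (gradingD (grbimod_grading M) hx hy).
- move=> x [s [t [a [b [ha hb <- ->]]]]].
  have -> : (env_pure a b *: m : env_mod M) = lact a (ract (m : M) b).
    exact: env_scalePure.
  rewrite -addrA [t + sigma]addrC.
  by apply: grbimod_lact => //; apply: grbimod_ract.
Qed.

Lemma env_mod_grading (M : grbimod) :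
  @grading G (env_mod M) (@grbimod_deg M).
Proof. by case: (grbimod_grading M) => ? ? ? ?; split. Qed.

Definition gr_env_mod (M : grbimod) : grmod env_deg :=
  @Grmod G (env A) env_deg (env_mod M) (@grbimod_deg M)
    (env_mod_grading M) (@env_mod_deg_scale M).

(* Isomorphism of bimodules, each with a family of homogeneous components. *)
Definition gr_bimod_iso (U V : bimod A) (DU : G -> set U) (DV : G -> set V) :=
  exists f : U -> V, is_bimod_iso f /\
    forall sigma x, DU sigma x <-> DV sigma (f x).

Definition tensor_deg (U V : grbimod) (gamma : G) : set (tensor_bimod U V) :=
  finite_sums [set x | exists tau sigma u v,
    [/\ @grbimod_deg U tau u, @grbimod_deg V sigma v, tau + sigma = gamma &
        x = tpure u v]].

Definition gr_invertible_bimod (U : grbimod) : Prop := exists V : grbimod,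
  gr_bimod_iso (@tensor_deg U V) (@grbimod_deg gr_regular_bimod) /\
  gr_bimod_iso (@tensor_deg V U) (@grbimod_deg gr_regular_bimod).

Definition hom_deg (P : grmod env_deg) (tau : G) : set (fun_bimod A P) :=
  [set f | is_hom f /\
    forall sigma x, grmod_deg sigma x -> env_deg (sigma + tau) (f x)].

Definition gr_hom (P : grmod env_deg) : set (fun_bimod A P) :=
  finite_sums [set f | exists tau, hom_deg tau f].

Lemma finite_sums0 (T : zmodType) (S : set T) : finite_sums S 0.
Proof. by exists [::]; split=> //; rewrite big_nil. Qed.
Lemma finite_sumsD (T : zmodType) (S : set T) x y :
  finite_sums S x -> finite_sums S y -> finite_sums S (x + y).
Proof.
move=> [s [hs ->]] [t [ht ->]]; exists (s ++ t); split; last by rewrite big_cat.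
by move=> z; rewrite mem_cat => /orP[/hs|/ht].
Qed.
Lemma finite_sums1 (T : zmodType) (S : set T) x : S x -> finite_sums S x.
Proof.
move=> Sx; exists [:: x]; split; last by rewrite big_cons big_nil addr0.
by move=> y; rewrite inE => /eqP ->.
Qed.
Lemma finite_sumsN (T : zmodType) (S : set T) :
  (forall x, S x -> S (- x)) -> forall x, finite_sums S x -> finite_sums S (- x).
Proof.
move=> SN; apply: (finite_sumsP (D := fun x => finite_sums S (- x))).
- by rewrite oppr0; apply: finite_sums0.
- by move=> x y hx hy; rewrite opprD; apply: finite_sumsD.
- by move=> x Sx; apply/finite_sums1/SN.
Qed.
Lemma finite_sums_sum (T : zmodType) (S : set T) (I : Type) (s : seq I)
    (f : I -> T) :
  (forall i, finite_sums S (f i)) -> finite_sums S (\sum_(i <- s) f i).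
Proof.
move=> h; elim: s => [|i s IHs]; first by rewrite big_nil; apply: finite_sums0.
by rewrite big_cons; apply: finite_sumsD.
Qed.

Lemma env_degN gamma x : env_deg gamma x -> env_deg gamma (- x).
Proof.
apply: finite_sumsN => {}x [s [t [a [b [ha hb hst ->]]]]].
exists s, t, (- a), b; split => //.
  by rewrite -sub0r; apply: (gradingB (galg_grading A)) => //;
    apply: (grading0 (galg_grading A)).
by apply/eqP; rewrite eq_sym -addr_eq0 -env_pureDl addNr; apply/eqP;
  apply: (@addrI _ (env_pure 0 b)); rewrite -env_pureDl !addr0.
Qed.

Lemma env_degMl sigma tau x b : env_deg sigma x -> galg_deg tau b ->
  env_deg (sigma + tau) (x * env_pure b 1).
Proof.
move=> hx hb; move: x hx.
apply: (finite_sumsP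
  (D := fun x => env_deg (sigma + tau) (x * env_pure b 1))).
- by rewrite mul0r; apply: finite_sums0.
- by move=> x y hx hy; rewrite mulrDl; apply: finite_sumsD.
move=> _ [s [t [c [d [hc hd <- ->]]]]]; apply: finite_sums1.
exists (s + tau), t, (c * b), d; split => //; first exact: galg_mul.
  by rewrite addrAC.
by rewrite env_pureM mul1r.
Qed.

Lemma env_degMr sigma tau x b : env_deg sigma x -> galg_deg tau b ->
  env_deg (sigma + tau) (x * env_pure 1 b).
Proof.
move=> hx hb; move: x hx.
apply: (finite_sumsP
  (D := fun x => env_deg (sigma + tau) (x * env_pure 1 b))).
- by rewrite mul0r; apply: finite_sums0.
- by move=> x y hx hy; rewrite mulrDl; apply: finite_sumsD.
move=> _ [s [t [c [d [hc hd <- ->]]]]]; apply: finite_sums1.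
exists s, (tau + t), c, (b * d); split => //; first exact: galg_mul.
  by rewrite -addrA [t + tau]addrC.
by rewrite env_pureM mulr1.
Qed.

Lemma gr_hom_is_hom (P : grmod env_deg) (f : fun_bimod A P) :
  gr_hom f -> is_hom f.
Proof.
apply: (finite_sumsP (D := fun f : fun_bimod A P => is_hom f)).
- exact: is_hom0.
- move=> {}f g [fD fZ] [gD gZ]; split=> [x y|r x].
    by rewrite -![(f + g) _]/(f _ + g _) fD gD addrACA.
  by rewrite -![(f + g) _]/(f _ + g _) fZ gZ mulrDr.
- by move=> g [tau []].
Qed.

Lemma gr_homN (P : grmod env_deg) (f : fun_bimod A P) :
  gr_hom f -> gr_hom (- f).
Proof.
apply: finite_sumsN => {}f [tau [fL fdeg]]; exists tau; split.
  by rewrite -sub0r; apply: is_homB => //; apply: is_hom0.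
by move=> sigma x hx; apply: env_degN; apply: fdeg.
Qed.

Lemma gr_homB (P : grmod env_deg) (f g : fun_bimod A P) :
  gr_hom f -> gr_hom g -> gr_hom (f - g).
Proof. by move=> hf hg; apply: finite_sumsD => //; apply: gr_homN. Qed.

Lemma gr_hom_act (P : grmod env_deg) (e : A -> env A) (f : fun_bimod A P) a :
  (forall x y, e (x + y) = e x + e y) ->
  (forall sigma tau x b, env_deg sigma x -> galg_deg tau b ->
     env_deg (sigma + tau) (x * e b)) ->
  gr_hom f -> @gr_hom P (fun x => f x * e a).
Proof.
move=> eD edeg; move: f.
apply: (finite_sumsP (D := fun f : fun_bimod A P =>
  @gr_hom P (fun x => f x * e a))).
- rewrite (_ : (fun _ => _) = 0 :> fun_bimod A P); first exact: finite_sums0.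
  by apply/funext => x; rewrite mul0r.
- move=> f g hf hg.
  rewrite (_ : (fun _ => _) = ((fun x => f x * e a) : fun_bimod A P) +
    ((fun x => g x * e a) : fun_bimod A P)); first exact: finite_sumsD.
  by apply/funext => x; rewrite -[RHS]/(f x * e a + g x * e a) -mulrDl.
move=> f [tau [fL fdeg]].
have [s [c [hc ->]]] := grading_span (galg_grading A) a.
have e0 : e 0 = 0 by apply: (addrI (e 0)); rewrite -eD !addr0.
rewrite (_ : (fun _ => _) =
    \sum_(sigma <- s) ((fun x => f x * e (c sigma)) : fun_bimod A P)); last first.
  apply/funext => x; elim: s => [|sigma s IHs].
    by rewrite !big_nil e0 mulr0.
  by rewrite !big_cons eD mulrDr IHs.
apply: finite_sums_sum => sigma; apply: finite_sums1; exists (tau + sigma).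
split; first exact: is_homM.
by move=> rho x hx; rewrite addrA; apply: edeg => //; apply: fdeg.
Qed.

Lemma gr_hom_lact (P : grmod env_deg) (f : fun_bimod A P) (a : A) :
  gr_hom f -> gr_hom (lact a f).
Proof. exact: (gr_hom_act _ (@env_pureDr k A 1) env_degMr). Qed.

Lemma gr_hom_ract (P : grmod env_deg) (f : fun_bimod A P) (a : A) :
  gr_hom f -> gr_hom (ract f a).
Proof.
exact: (gr_hom_act _ (@env_pureDl k A 1) env_degMl).
Qed.

Section GradedCohomology.
Variables (P : nat -> grmod env_deg).
Variable d : forall n, {linear P n.+1 -> P n}.

Definition gr_cocycle (i : nat) : set (fun_bimod A (P i)) :=
  [set f | gr_hom f /\ forall x, f (d i x) = 0].

Definition gr_coboundary (i : nat) : set (fun_bimod A (P i)) :=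
  match i with
  | 0 => [set f | f = 0]
  | j.+1 => [set f | exists2 g : P j -> env A, @gr_hom (P j) g &
                       f = fun x => g (d j x)]
  end.

Definition gr_cocycles (i : nat) : subbimod (fun_bimod A (P i)).
Proof.
apply: (@Subbimod k A _ (@gr_cocycle i)).
- by split=> //; apply: finite_sums0.
- move=> f g [fL fd] [gL gd]; split; first exact: gr_homB.
  by move=> x; rewrite -![(f - g) _]/(f _ - g _) fd gd subr0.
- move=> a f [fL fd]; split; first exact: gr_hom_lact.
  by move=> x; rewrite /= fd mul0r.
- move=> f a [fL fd]; split; first exact: gr_hom_ract.
  by move=> x; rewrite /= fd mul0r.
Defined.

Definition gr_coboundaries (i : nat) : subbimod (fun_bimod A (P i)).
Proof.
apply: (@Subbimod k A _ (@gr_coboundary i)); case: i => [|j] /=.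
- by [].
- by exists (0 : fun_bimod A (P j)) => //; apply: finite_sums0.
- by move=> f g -> ->; rewrite subr0.
- move=> f g [f' f'L ->] [g' g'L ->].
  by exists ((f' : fun_bimod A (P j)) - g') => //; apply: gr_homB.
- by move=> a f ->; apply/funext => x; rewrite /= mul0r.
- move=> a f [f' f'L ->]; exists (fun x => f' x * env_pure 1 a) => //.
  exact: (gr_hom_lact a f'L).
- by move=> f a ->; apply/funext => x; rewrite /= mul0r.
- move=> f a [f' f'L ->]; exists (fun x => f' x * env_pure a 1) => //.
  exact: (gr_hom_ract a f'L).
Defined.

Definition gr_cohomology (i : nat) : bimod A :=
  subquot (gr_cocycles i) (gr_coboundaries i).

Definition gr_cohomology_deg (i : nat) (tau : G) : set (gr_cohomology i) :=
  [set e | exists2 z : sub_bimod (gr_cocycles i),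
     hom_deg tau (sub_val z) & e = subquot_class (gr_coboundaries i) z].
End GradedCohomology.

Definition gr_Ext (M : grmod env_deg) (P : gr_resolution M) (i : nat) :
  bimod A := gr_cohomology (@gres_diff _ _ _ _ P) i.

Definition gr_Ext_deg (M : grmod env_deg) (P : gr_resolution M) (i : nat) :
  G -> set (gr_Ext P i) := @gr_cohomology_deg _ (@gres_diff _ _ _ _ P) i.

Definition gr_homologically_smooth : Prop :=
  exists P : gr_resolution (gr_env_mod gr_regular_bimod),
    (forall i, gr_projective (P i) /\ finitely_generated (P i)) /\
    finite_length (fun i => P i).

Definition gr_twisted_CY (d : nat) : Prop :=
  gr_homologically_smooth /\
  exists U : grbimod, gr_invertible_bimod U /\
    forall P : gr_resolution (gr_env_mod gr_regular_bimod),
      (forall i, gr_projective (P i)) ->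
      (forall i, i <> d -> bimod_zero (gr_Ext P i)) /\
      gr_bimod_iso (@gr_Ext_deg _ P d) (@grbimod_deg U).
End Graded.

(* Main.v *)
Require Import Defs.
From HB Require Import structures.
From mathcomp Require Import all_boot all_algebra.
From mathcomp Require Import boolp classical_sets functions.

(** Write [E] for the enveloping algebra of [A]; it is graded by [G], and both
    notions of Calabi-Yau algebra ask for a finite resolution of [A] by finitely
    generated projective [E]-modules and for a description of the cohomology of
    the dual of such a resolution. The equivalence rests on three facts.

    A graded module is projective as an object of the graded category exactly
    when it is projective as a module, at least when it is finitely generated:
    the degree 0 component of a linear splitting is a graded splitting
    ([projective_gr_projective]), and a finitely generated graded projective is
    a summand of a graded free module ([gr_projective_projective]). So a graded
    finite resolution is a finite resolution. Conversely, if [A] has a finite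
    resolution of length n by finitely generated projectives, then covering [A]
    and the successive kernels by graded free modules of finite rank reaches,
    after n steps, a kernel which Schanuel's lemma ([schanuel]) shows to be
    finitely generated projective ([fp_dim_gr_resolution]).

    On a finitely generated graded module every functional is a finite sum of
    homogeneous ones ([fg_gr_hom]). Hence for a graded resolution by finitely
    generated projectives the graded and the ungraded Ext bimodules coincide
    ([fg_gr_Ext]), and the graded Ext is a graded bimodule
    ([gr_cohomology_grading]). Any other resolution, graded or not, is reached
    by the comparison theorem for projective resolutions ([Ext_iso] and
    [gr_Ext_iso]), proved once for both categories ([htpy_equiv_exists]).

    A graded bimodule [U] that is invertible as a bimodule is invertible as a
    graded one ([invertible_gr_invertible]). The two isomorphisms of [U (x) V]
    and [V (x) U] with [A] can be chosen compatible ([invertible_compatible]);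
    then [V] is the left dual of [U] and [U] has a finite dual basis, so that
    the degrees of functionals on [U] grade [V] ([inverse_grading]).

    Homogeneous components of elements and of additive maps ([gcomp] and
    [fcomp]) are the common tool. *)

Set Implicit Arguments.
Unset Strict Implicit.
Unset Printing Implicit Defensive.

Import GRing.Theory.
Local Open Scope ring_scope.
Local Open Scope classical_set_scope.

(** * Homogeneous components *)

Section AdditiveMaps.
Variables (M N : zmodType) (f : M -> N).
Hypothesis fD : {morph f : x y / x + y}.

Lemma morph_add0 : f 0 = 0.
Proof. by apply: (addrI (f 0)); rewrite -fD !addr0. Qed.

Lemma morph_addN x : f (- x) = - f x.
Proof. by apply: (addrI (f x)); rewrite -fD !subrr morph_add0. Qed.

Lemma morph_addB x y : f (x - y) = f x - f y.
Proof. by rewrite fD morph_addN. Qed.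

Lemma morph_add_sum (I : Type) (s : seq I) (F : I -> M) :
  f (\sum_(i <- s) F i) = \sum_(i <- s) f (F i).
Proof. exact: (big_morph f fD morph_add0). Qed.
End AdditiveMaps.

Lemma sum_support (I : eqType) (V : zmodType) (c : I -> V) (s t : seq I) :
  uniq s -> uniq t -> {subset s <= t} -> (forall i, i \notin s -> c i = 0) ->
  \sum_(i <- t) c i = \sum_(i <- s) c i.
Proof.
move=> us ut st c0; rewrite (bigID (mem s)) /= [X in _ + X]big1 // addr0.
rewrite -big_filter; apply: perm_big; apply: uniq_perm => //.
  exact: filter_uniq.
by move=> i; rewrite mem_filter; case: (boolP (i \in s)) => //= /st ->.
Qed.

Section Components.
Variables (G M : zmodType) (D : G -> set M).
Hypothesis gD : grading D.

Lemma grading_decomp x : exists cs : (G -> M) * seq G,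
  [/\ uniq cs.2, forall sigma, D sigma (cs.1 sigma),
      forall sigma, sigma \notin cs.2 -> cs.1 sigma = 0 &
      x = \sum_(sigma <- cs.2) cs.1 sigma].
Proof.
have [s [f [Df ->]]] := grading_span gD x.
(* [s] may repeat degrees, whence the multiplicities *)
exists (fun sigma => f sigma *+ count_mem sigma s, undup s).
split=> /= [|sigma|sigma|]; first exact: undup_uniq.
- elim: (count_mem sigma s) => [|n IHn]; first exact: (grading0 gD).
  by rewrite mulrS; apply: (gradingD gD).
- by rewrite mem_undup => /count_memPn ->.
- by rewrite -[LHS]big_undup_iterop_count.
Qed.

(** The decomposition is unique ([gcomp_unique]); only the support involves an
    arbitrary choice. *)
Definition gcomp x : G -> M := (projT1 (cid (grading_decomp x))).1.
Definition gsupp x : seq G := (projT1 (cid (grading_decomp x))).2.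

Lemma gcompP x : [/\ uniq (gsupp x), forall sigma, D sigma (gcomp x sigma),
      forall sigma, sigma \notin gsupp x -> gcomp x sigma = 0 &
      x = \sum_(sigma <- gsupp x) gcomp x sigma].
Proof. exact: (projT2 (cid (grading_decomp x))). Qed.

Lemma gcomp_deg x sigma : D sigma (gcomp x sigma).
Proof. by case: (gcompP x). Qed.

Lemma gcomp_out x sigma : sigma \notin gsupp x -> gcomp x sigma = 0.
Proof. by case: (gcompP x) => _ _ h _; apply: h. Qed.

Lemma sum_gcomp x s : uniq s -> {subset gsupp x <= s} ->
  \sum_(sigma <- s) gcomp x sigma = x.
Proof.
move=> us xs; case: (gcompP x) => ux _ x0 xE; rewrite [RHS]xE.
exact: sum_support.
Qed.

Lemma gcomp_unique x (c : G -> M) s : (forall sigma, D sigma (c sigma)) ->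
  uniq s -> (forall sigma, sigma \notin s -> c sigma = 0) ->
  x = \sum_(sigma <- s) c sigma -> forall sigma, gcomp x sigma = c sigma.
Proof.
move=> Dc us c0 xE sigma.
pose t := undup (s ++ gsupp x).
have st : {subset s <= t} by move=> i; rewrite mem_undup mem_cat => ->.
have xt : {subset gsupp x <= t}.
  by move=> i; rewrite mem_undup mem_cat => ->; rewrite orbT.
have [it|it] := boolP (sigma \in t); last first.
  by rewrite c0 ?gcomp_out //; move: it; apply: contra; [apply: xt|apply: st].
apply/eqP; rewrite -subr_eq0; apply/eqP.
apply: (grading_indep gD (s := t) (f := fun i => gcomp x i - c i)) => //.
- exact: undup_uniq.
- by move=> i; apply: (gradingB gD) => //; apply: gcomp_deg.
- rewrite sumrB sum_gcomp ?undup_uniq // (@sum_support _ _ _ s) -?xE ?subrr //.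
  exact: undup_uniq.
Qed.

Lemma gcompD sigma : {morph gcomp^~ sigma : x y / x + y}.
Proof.
move=> x y; pose s := undup (gsupp x ++ gsupp y).
have xs : {subset gsupp x <= s} by move=> i; rewrite mem_undup mem_cat => ->.
have ys : {subset gsupp y <= s}.
  by move=> i; rewrite mem_undup mem_cat => ->; rewrite orbT.
apply: (gcomp_unique (c := fun i => gcomp x i + gcomp y i) (s := s)).
- by move=> i; apply: (gradingD gD); apply: gcomp_deg.
- exact: undup_uniq.
- by move=> i; rewrite mem_undup mem_cat negb_or => /andP[? ?];
    rewrite !gcomp_out ?addr0.
- by rewrite big_split /= !sum_gcomp ?undup_uniq.
Qed.

Lemma gcomp0 sigma : gcomp 0 sigma = 0.
Proof. exact: (morph_add0 (gcompD sigma)). Qed.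

Lemma gcomp_homog sigma tau x : D sigma x ->
  gcomp x tau = if tau == sigma then x else 0.
Proof.
move=> Dx; apply: (gcomp_unique (c := fun i => if i == sigma then x else 0)
  (s := [:: sigma])) => //.
- by move=> i; case: eqP => [->|_] //; apply: (grading0 gD).
- by move=> i; rewrite inE => /negPf ->.
- by rewrite big_seq1 eqxx.
Qed.

(** An additive statement about a graded group needs checking on homogeneous
    elements only; most identities below are proved this way. *)
Lemma grading_ind (Q : M -> Prop) : Q 0 ->
  (forall x y, Q x -> Q y -> Q (x + y)) ->
  (forall sigma x, D sigma x -> Q x) -> forall x, Q x.
Proof.
move=> Q0 QD QH x; case: (gcompP x) => _ _ _ ->.
by apply: (big_ind Q) => // sigma _; apply/QH/gcomp_deg.
Qed.

Lemma grading_ext (N : zmodType) (f g : M -> N) :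
  {morph f : x y / x + y} -> {morph g : x y / x + y} ->
  (forall sigma x, D sigma x -> f x = g x) -> forall x, f x = g x.
Proof.
move=> fD gD' fg; apply: grading_ind => [|x y fx fy|//].
  by rewrite !morph_add0.
by rewrite fD gD' fx fy.
Qed.

(** Additive extension of maps given on homogeneous elements. The sum runs over
    a support that varies with [x], whence the care in [gextD]. *)
Definition gext (N : zmodType) (F : G -> M -> N) (x : M) : N :=
  \sum_(sigma <- gsupp x) F sigma (gcomp x sigma).

Section Extension.
Variables (N : zmodType) (F : G -> M -> N).
Hypothesis FD : forall sigma, {morph F sigma : x y / x + y}.

Lemma gextE x s : uniq s -> {subset gsupp x <= s} ->
  gext F x = \sum_(sigma <- s) F sigma (gcomp x sigma).
Proof.
move=> us xs; apply/esym/sum_support => //; first by case: (gcompP x).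
by move=> i /gcomp_out ->; apply: morph_add0.
Qed.

Lemma gextD : {morph gext F : x y / x + y}.
Proof.
move=> x y; pose s := undup (gsupp x ++ gsupp y ++ gsupp (x + y)).
have us : uniq s by apply: undup_uniq.
rewrite !(gextE us); first rewrite -big_split /=.
- by apply: eq_bigr => sigma _; rewrite gcompD FD.
- by move=> i; rewrite mem_undup !mem_cat => ->; rewrite orbT.
- by move=> i; rewrite mem_undup !mem_cat => ->.
- by move=> i; rewrite mem_undup !mem_cat => ->; rewrite !orbT.
Qed.

Lemma gext_homog sigma x : D sigma x -> gext F x = F sigma x.
Proof.
move=> Dx; rewrite (@gextE _ (undup (sigma :: gsupp x))) ?undup_uniq //; last first.
  by move=> i; rewrite mem_undup inE => ->; rewrite orbT.
rewrite (@sum_support _ _ _ [:: sigma]) ?undup_uniq //.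
- by rewrite big_seq1 (gcomp_homog _ Dx) eqxx.
- by move=> i; rewrite inE => /eqP ->; rewrite mem_undup mem_head.
- move=> i; rewrite inE (gcomp_homog _ Dx) => /negPf ->.
  exact: morph_add0.
Qed.
End Extension.
End Components.

Section Shift.
Variables (G M N : zmodType) (DM : G -> set M) (DN : G -> set N).
Hypotheses (gM : grading DM) (gN : grading DN).

(** Components are natural in homogeneous maps of any degree. *)
Lemma gcomp_shift (L : M -> N) rho : {morph L : x y / x + y} ->
  (forall sigma x, DM sigma x -> DN (rho + sigma) (L x)) ->
  forall sigma x, gcomp gN (L x) (rho + sigma) = L (gcomp gM x sigma).
Proof.
move=> LD Ldeg sigma; apply: (grading_ext gM) => [x y|x y|tau x Dx].
- by rewrite LD gcompD.
- by rewrite gcompD LD.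
rewrite (gcomp_homog _ _ (Ldeg _ _ Dx)) (gcomp_homog _ _ Dx).
by rewrite (can_eq (addKr rho)); case: eqP => // _; rewrite morph_add0.
Qed.

End Shift.

Section MapComponents.
Variables (G M N : zmodType) (DM : G -> set M) (DN : G -> set N).
Hypotheses (gM : grading DM) (gN : grading DN).

(** The component of degree tau of an additive map. *)
Definition fcomp (tau : G) (f : M -> N) : M -> N :=
  gext gM (fun sigma y => gcomp gN (f y) (sigma + tau)).

Section OneMap.
Variable f : M -> N.
Hypothesis fD : {morph f : x y / x + y}.

Let compD tau sigma : {morph (fun y => gcomp gN (f y) (sigma + tau)) : x y / x + y}.
Proof. by move=> x y; rewrite fD gcompD. Qed.

Lemma fcompD tau : {morph fcomp tau f : x y / x + y}.
Proof. exact: (gextD gM (compD tau)). Qed.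

Lemma fcomp_homog tau sigma x : DM sigma x ->
  fcomp tau f x = gcomp gN (f x) (sigma + tau).
Proof. exact: (gext_homog gM (compD tau)). Qed.

Lemma fcomp_deg tau sigma x : DM sigma x -> DN (sigma + tau) (fcomp tau f x).
Proof. by move=> /fcomp_homog ->; apply: gcomp_deg. Qed.

Lemma fcomp_of_homog rho tau :
  (forall sigma x, DM sigma x -> DN (sigma + rho) (f x)) ->
  forall x, fcomp tau f x = if tau == rho then f x else 0.
Proof.
move=> fdeg; apply: (grading_ext gM) => [||sigma x Dx]; first exact: fcompD.
  by move=> x y; case: eqP; rewrite ?addr0.
by rewrite (fcomp_homog _ Dx) (gcomp_homog _ _ (fdeg _ _ Dx)) (can_eq (addKr sigma)).
Qed.

(** On a homogeneous [x] of degree sigma the components are those of [f x],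
    shifted by sigma; there are finitely many of them, but their number is
    unbounded as [x] varies. *)
Lemma fcomp_finite x : exists s : seq G, forall t, uniq t -> {subset s <= t} ->
  \sum_(tau <- t) fcomp tau f x = f x.
Proof.
apply: (grading_ind gM (Q := fun x => exists s : seq G,
  forall t, uniq t -> {subset s <= t} -> \sum_(tau <- t) fcomp tau f x = f x))
  => {x} [|x y [s sE] [t tE]|sigma x Dx].
- exists [::] => t _ _; rewrite (morph_add0 fD).
  by rewrite big1 // => tau _; apply: morph_add0; apply: fcompD.
- exists (s ++ t) => u uu stu; rewrite fD -(sE u) // -?(tE u) //; last first.
  + by move=> i it; apply: stu; rewrite mem_cat it.
  + by move=> i it; apply: stu; rewrite mem_cat it orbT.
  by rewrite -big_split; apply: eq_bigr => tau _; apply: fcompD.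
- exists [seq rho - sigma | rho <- gsupp gN (f x)] => t ut st.
  under eq_bigr do rewrite (fcomp_homog _ Dx).
  rewrite -[RHS](@sum_gcomp _ _ _ gN _ [seq sigma + tau | tau <- t]).
  + by rewrite big_map.
  + by rewrite map_inj_uniq //; apply: addrI.
  + move=> rho hrho; apply/mapP; exists (rho - sigma); last by rewrite addrCA subrr addr0.
    by apply/st/map_f.
Qed.

Lemma fcomp_finite_seq (e : seq M) : exists2 t : seq G, uniq t &
  forall x, x \in e -> \sum_(tau <- t) fcomp tau f x = f x.
Proof.
suff [s sE] : exists s : seq G, forall t, uniq t -> {subset s <= t} ->
    forall x, x \in e -> \sum_(tau <- t) fcomp tau f x = f x.
  exists (undup s); first exact: undup_uniq.
  by apply: sE; [exact: undup_uniq | move=> i; rewrite mem_undup].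
elim: e => [|x e [s sE]]; first by exists [::].
have [r rE] := fcomp_finite x; exists (r ++ s) => t ut rst y.
rewrite inE => /orP[/eqP ->|ye].
  by apply: rE => // i ir; apply: rst; rewrite mem_cat ir.
by apply: sE => // i ir; apply: rst; rewrite mem_cat ir orbT.
Qed.

Lemma fcomp_comm (LM : M -> M) (LN : N -> N) rho tau :
  {morph LM : x y / x + y} -> {morph LN : x y / x + y} ->
  (forall sigma x, DM sigma x -> DM (rho + sigma) (LM x)) ->
  (forall sigma x, DN sigma x -> DN (rho + sigma) (LN x)) ->
  (forall x, f (LM x) = LN (f x)) ->
  forall x, fcomp tau f (LM x) = LN (fcomp tau f x).
Proof.
move=> LMD LND LMdeg LNdeg fL.
apply: (grading_ext gM) => [x y|x y|sigma x Dx].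
- by rewrite LMD fcompD.
- by rewrite fcompD LND.
by rewrite (fcomp_homog _ (LMdeg _ _ Dx)) (fcomp_homog _ Dx) fL -addrA (gcomp_shift gN).
Qed.

(** If [f] is linear over a graded ring, then so are its components: enough
    for homogeneous scalars, since both sides are additive in the scalar. *)
Lemma fcomp_linear (S : zmodType) (DS : G -> set S)
    (aM : S -> M -> M) (aN : S -> N -> N) tau :
  grading DS ->
  (forall x, {morph aM^~ x : a b / a + b}) ->
  (forall x, {morph aN^~ x : a b / a + b}) ->
  (forall a, {morph aM a : x y / x + y}) ->
  (forall a, {morph aN a : x y / x + y}) ->
  (forall rho sigma a x, DS rho a -> DM sigma x -> DM (rho + sigma) (aM a x)) ->
  (forall rho sigma a x, DS rho a -> DN sigma x -> DN (rho + sigma) (aN a x)) ->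
  (forall a x, f (aM a x) = aN a (f x)) ->
  forall a x, fcomp tau f (aM a x) = aN a (fcomp tau f x).
Proof.
move=> gS aMDl aNDl aMDr aNDr aMdeg aNdeg fL a x; move: a.
apply: (grading_ext gS) => [a b|a b|rho a Da].
- by rewrite aMDl fcompD.
- exact: aNDl.
by apply: (fcomp_comm (rho := rho)) => // *; [apply: aMdeg|apply: aNdeg].
Qed.
End OneMap.

Lemma fcomp_add tau (f g : M -> N) : {morph f : x y / x + y} ->
  {morph g : x y / x + y} ->
  forall x, fcomp tau (fun y => f y + g y) x = fcomp tau f x + fcomp tau g x.
Proof.
move=> fD gD; have fgD : {morph (fun y => f y + g y) : x y / x + y}.
  by move=> x y; rewrite fD gD addrACA.
apply: (grading_ext gM) => [|x y|sigma x Dx]; first exact: fcompD.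
  by rewrite !fcompD // addrACA.
by rewrite !(fcomp_homog _ _ Dx) // gcompD.
Qed.
End MapComponents.

Lemma fcomp_precomp (G L M N : zmodType) (DL : G -> set L) (DM : G -> set M)
    (DN : G -> set N) (gL : grading DL) (gM : grading DM) (gN : grading DN)
    (tau : G) (f : M -> N) (h : L -> M) :
  {morph f : x y / x + y} -> {morph h : x y / x + y} ->
  (forall sigma x, DL sigma x -> DM sigma (h x)) ->
  forall x, fcomp gL gN tau (fun y => f (h y)) x = fcomp gM gN tau f (h x).
Proof.
move=> fD hD hdeg; have fhD : {morph (fun y => f (h y)) : x y / x + y}.
  by move=> x y; rewrite hD fD.
apply: (grading_ext gL) => [|x y|sigma x Dx]; first exact: fcompD.
  by rewrite hD fcompD.
by rewrite (fcomp_homog _ _ fhD _ Dx) (fcomp_homog _ _ fD _ (hdeg _ _ Dx)).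
Qed.

(** Repeated degrees are merged by adding up the summands of equal degree. *)
Lemma grading_span_sums (G M : zmodType) (D : G -> set M) :
  (forall sigma, D sigma 0) ->
  (forall sigma x y, D sigma x -> D sigma y -> D sigma (x + y)) ->
  forall x, finite_sums [set y | exists sigma, D sigma y] x ->
  exists (s : seq G) (f : G -> M),
    (forall sigma, D sigma (f sigma)) /\ x = \sum_(sigma <- s) f sigma.
Proof.
move=> D0 DD _ [l [lD ->]].
have /choice [deg degP] : forall y, exists sigma, y \in l -> D sigma y.
  move=> y; case: (boolP (y \in l)) => [/lD [sigma Dy]|_]; first by exists sigma.
  by exists 0.
exists (undup (map deg l)), (fun sigma => \sum_(y <- l | deg y == sigma) y); split.
  move=> sigma; rewrite big_seq_cond; apply: big_ind => //; first exact: DD.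
  by move=> y /andP[yl /eqP <-]; apply: degP.
rewrite (exchange_big_dep predT) //= big_seq [RHS]big_seq.
apply: eq_bigr => y yl; rewrite -big_filter.
rewrite (perm_big [:: deg y]) ?big_seq1 //; apply: uniq_perm => //.
  exact/filter_uniq/undup_uniq.
move=> i; rewrite mem_filter inE mem_undup eq_sym.
by case: eqP => // ->; rewrite map_f.
Qed.

(** The components of [f x] outside degree sigma vanish, hence so do those of
    [x] by injectivity. This is how degree-preserving isomorphisms become
    isomorphisms of graded objects. *)
Lemma degree_reflect (G M N : zmodType) (DM : G -> set M) (DN : G -> set N)
    (f : M -> N) : grading DN ->
  (forall x, exists (s : seq G) (c : G -> M),
    (forall sigma, DM sigma (c sigma)) /\ x = \sum_(sigma <- s) c sigma) ->
  (forall sigma, DM sigma 0) ->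
  (forall sigma x y, DM sigma x -> DM sigma y -> DM sigma (x + y)) ->
  {morph f : x y / x + y} -> injective f ->
  (forall sigma x, DM sigma x -> DN sigma (f x)) ->
  forall sigma x, DM sigma x <-> DN sigma (f x).
Proof.
move=> gN DMspan DM0 DMD fD finj fdeg sigma x; split; first exact: fdeg.
have [s [c [Dc ->]]] := DMspan x => Dfx.
rewrite (_ : \sum_(i <- s) c i = \sum_(i <- s | i == sigma) c i).
  by apply: (big_ind (DM sigma)) => // [y z|i /eqP <-//]; apply: DMD.
apply: finj; transitivity (gcomp gN (f (\sum_(i <- s) c i)) sigma).
  by rewrite (gcomp_homog _ _ Dfx) eqxx.
rewrite (morph_add_sum fD) (morph_add_sum (gcompD gN sigma)) [in RHS]big_mkcond.
rewrite (morph_add_sum fD); apply: eq_bigr => i _.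
rewrite (gcomp_homog _ _ (fdeg _ _ (Dc i))) eq_sym.
by case: eqP => // _; rewrite morph_add0.
Qed.

(** * Submodules, generators and projectives *)

Section LinearMaps.
Variables (R : pzRingType) (U V : lmodType R).

Definition mklinear (f : U -> V) (fL : linear f) : {linear U -> V} :=
  HB.pack f (GRing.isLinear.Build R U V *:%R f fL).

Lemma linear_add (f : {linear U -> V}) : {morph f : x y / x + y}.
Proof. exact: linearD. Qed.
End LinearMaps.

Lemma linear_bij_inv (R : pzRingType) (U V : lmodType R) (f : {linear U -> V}) : bijective f ->
  exists2 g : {linear V -> U}, cancel f g & cancel g f.
Proof.
move=> [g fK gK]; have gL : linear g.
  by move=> r x y; apply: (can_inj fK); rewrite linearP !gK.
by exists (mklinear gL).
Qed.

Section Submodules.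
Variable R : pzRingType.

Record submodule (M : lmodType R) := Submodule {
  sm_set :> M -> Prop;
  sm0 : sm_set 0;
  smL : forall r x y, sm_set x -> sm_set y -> sm_set (r *: x + y) }.

Section SubmoduleType.
Variables (M : lmodType R) (S : submodule M).

Lemma smD x y : S x -> S y -> S (x + y).
Proof. by move=> Sx Sy; rewrite -[x]scale1r; apply: smL. Qed.

Lemma smZ r x : S x -> S (r *: x).
Proof. by move=> Sx; rewrite -[_ *: _]addr0; apply: smL => //; apply: sm0. Qed.

Lemma sm_sum (I : Type) (s : seq I) (P : pred I) (F : I -> M) :
  (forall i, P i -> S (F i)) -> S (\sum_(i <- s | P i) F i).
Proof. by move=> SF; apply: big_ind => //; [apply: sm0|apply: smD]. Qed.

Definition sm_pred : {pred M} := fun x => `[< S x >].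

Lemma sm_predP x : reflect (S x) (x \in sm_pred).
Proof. exact: asboolP. Qed.

Lemma sm_submod_closed : GRing.subsemimod_closed sm_pred.
Proof.
split; first split; first exact/sm_predP/sm0.
  by move=> x y /sm_predP Sx /sm_predP Sy; apply/sm_predP/smD.
by move=> r x /sm_predP Sx; apply/sm_predP/smZ.
Qed.

HB.instance Definition _ := GRing.isSubmodClosed.Build R M sm_pred sm_submod_closed.

Record smod_car := SmodCar { smod_incl : M; _ : smod_incl \in sm_pred }.
HB.instance Definition _ := [isSub for smod_incl].
HB.instance Definition _ := [Choice of smod_car by <:].
HB.instance Definition _ := [SubChoice_isSubLmodule of smod_car by <:].

Definition smod : lmodType R := smod_car.

Lemma smod_inP (x : smod) : S (smod_incl x).
Proof. by apply/sm_predP; case: x. Qed.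

Definition smod_in (x : M) (Sx : S x) : smod := SmodCar (introT (sm_predP x) Sx).

Lemma smod_incl_linear : linear (smod_incl : smod -> M).
Proof. by []. Qed.
Definition sm_incl : {linear smod -> M} := mklinear smod_incl_linear.

Lemma sm_incl_inj : injective sm_incl.
Proof. exact: val_inj. Qed.

Lemma smod_corestrict (N : lmodType R) (f : {linear N -> M}) :
  (forall x, S (f x)) ->
  exists g : {linear N -> smod}, forall x, smod_incl (g x) = f x.
Proof.
move=> Sf; have gL : linear (fun x => smod_in (Sf x)).
  by move=> r x y; apply: val_inj; rewrite /= linearP.
by exists (mklinear gL).
Qed.
End SubmoduleType.

Section KernelImage.
Variables (M N : lmodType R) (f : {linear M -> N}).

Definition ker_sm : submodule M.
Proof.
apply: (@Submodule M [set x | f x = 0]) => [|r x y /= fx fy].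
  exact: linear0.
by rewrite linearP fx fy scaler0 addr0.
Defined.

Definition im_sm : submodule N.
Proof.
apply: (@Submodule N [set y | exists x, f x = y]) => [|r _ _ [x <-] [y <-]].
  by exists 0; apply: linear0.
by exists (r *: x + y); rewrite linearP.
Defined.
End KernelImage.

(** Generation as an induction principle over submodules: it passes to images
    and products without reindexing coefficients. *)
Definition generates (M : lmodType R) (s : seq M) : Prop :=
  forall S : submodule M, (forall x, x \in s -> S x) -> forall m, S m.

Definition span_sm (M : lmodType R) (n : nat) (e : 'I_n -> M) : submodule M.
Proof.
apply: (@Submodule M [set m | exists c : 'I_n -> R, m = \sum_i c i *: e i]).
  by exists (fun=> 0); rewrite big1 // => i _; rewrite scale0r.
move=> r _ _ [c ->] [d ->]; exists (fun i => r * c i + d i).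
rewrite scaler_sumr -big_split; apply: eq_bigr => i _.
by rewrite scalerDl scalerA.
Defined.

Lemma span_sm_gen (M : lmodType R) (n : nat) (e : 'I_n -> M) i : span_sm e (e i).
Proof.
exists (fun j => (j == i)%:R); rewrite (bigD1 i) //= eqxx scale1r big1 ?addr0 //.
by move=> j /negPf ->; rewrite scale0r.
Qed.

Lemma finitely_generatedP (M : lmodType R) :
  finitely_generated M <-> exists s : seq M, generates s.
Proof.
split=> [[s sM]|[s sM]]; exists s.
  move=> S Ss m; have [c ->] := sM m; apply: sm_sum => i _.
  by apply/smZ/Ss/mem_nth.
move=> m; apply: (sM (span_sm (fun i : 'I_(size s) => s`_i))) => x xs.
have xi : (index x s < size s)%N by rewrite index_mem.
by have := @span_sm_gen M (size s) (fun i => s`_i) (Ordinal xi); rewrite /= nth_index.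
Qed.

Lemma fg_image (M N : lmodType R) (f : {linear M -> N}) :
  surjective f -> finitely_generated M -> finitely_generated N.
Proof.
move=> fS /finitely_generatedP[s sM]; apply/finitely_generatedP.
exists (map f s) => S Ss y; have [x <-] := fS y.
have preL : forall r x y, S (f x) -> S (f y) -> S (f (r *: x + y)).
  by move=> r u v Su Sv; rewrite linearP; apply: smL.
have pre0 : S (f 0) by rewrite linear0; apply: sm0.
apply: (sM (@Submodule M [set x | S (f x)] pre0 preL)) => u us.
exact/Ss/map_f.
Qed.

Lemma fg_prod (M N : lmodType R) :
  finitely_generated M -> finitely_generated N ->
  finitely_generated (M * N)%type.
Proof.
move=> /finitely_generatedP[s sM] /finitely_generatedP[t tN].
apply/finitely_generatedP.
exists ([seq (x, 0) | x <- s] ++ [seq (0, y) | y <- t]) => S Sst [m n].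
have S1 : S (m, 0).
  have S1L : forall r x y, S (x, 0) -> S (y, 0) -> S (r *: x + y, 0).
    move=> r x y Sx Sy; rewrite (_ : (_, _) = r *: (x, 0) + (y, 0)); first exact: smL.
    by congr pair; rewrite /= scaler0 addr0.
  apply: (sM (@Submodule M [set x | S (x, 0)] (sm0 S) S1L)) => x xs.
  by apply: Sst; rewrite mem_cat map_f.
have S2 : S (0, n).
  have S2L : forall r x y, S (0, x) -> S (0, y) -> S (0, r *: x + y).
    move=> r x y Sx Sy; rewrite (_ : (_, _) = r *: (0, x) + (0, y)); first exact: smL.
    by congr pair; rewrite /= scaler0 addr0.
  apply: (tN (@Submodule N [set x | S (0, x)] (sm0 S) S2L)) => x xs.
  by apply: Sst; rewrite mem_cat map_f ?orbT.
rewrite (_ : (m, n) = (m, 0) + (0, n)); first exact: smD.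
by congr pair; rewrite /= ?addr0 ?add0r.
Qed.

Lemma projective_retract (P Q : lmodType R) (i : {linear Q -> P})
    (r : {linear P -> Q}) : cancel i r -> projective P -> projective Q.
Proof.
move=> iK Pproj M N f g fS; have [h hE] := Pproj M N f (g \o r)%FUN fS.
by exists (h \o i)%FUN => x; rewrite /= hE /= iK.
Qed.

Lemma projective_prod (P Q : lmodType R) :
  projective P -> projective Q -> projective (P * Q)%type.
Proof.
move=> Pp Qp M N f g fS.
have g1L : linear (fun x : P => g (x, 0)).
  by move=> r x y; rewrite -linearP; congr (g _); congr pair; rewrite /= scaler0 addr0.
have g2L : linear (fun y : Q => g (0, y)).
  by move=> r x y; rewrite -linearP; congr (g _); congr pair; rewrite /= scaler0 addr0.
have [h1 h1E] := Pp M N f (mklinear g1L) fS.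
have [h2 h2E] := Qp M N f (mklinear g2L) fS.
have hL : linear (fun u : P * Q => h1 u.1 + h2 u.2).
  by move=> r x y; rewrite /= !linearP scalerDr addrACA.
exists (mklinear hL) => -[x y]; rewrite /= linearD h1E h2E /= -linearD.
by congr (g _); congr pair; rewrite /= ?addr0 ?add0r.
Qed.

Definition comb (M : lmodType R) (n : nat) (e : 'I_n -> M) (x : 'rV[R]_n) : M :=
  \sum_i x 0 i *: e i.

Lemma comb_linear (M : lmodType R) (n : nat) (e : 'I_n -> M) : linear (comb e).
Proof.
move=> r x y; rewrite /comb scaler_sumr -big_split; apply: eq_bigr => i _.
by rewrite !mxE scalerDl scalerA.
Qed.

Lemma row_comb n (x : 'rV[R]_n) : x = comb (fun i => delta_mx 0 i) x.
Proof. exact: row_sum_delta. Qed.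

Lemma comb_map (M N : lmodType R) (f : {linear M -> N}) n (e : 'I_n -> M) x :
  f (comb e x) = comb (fun i => f (e i)) x.
Proof. by rewrite linear_sum; apply: eq_bigr => i _; rewrite linearZ. Qed.

Lemma free_projective n : projective 'rV[R]_n.
Proof.
move=> M N f g fS; have [m mE] := choice (fun i => fS (g (delta_mx 0 i))).
exists (mklinear (comb_linear m)) => x; rewrite /= comb_map.
by rewrite [in RHS](row_comb x) comb_map; apply: eq_bigr => i _; rewrite mE.
Qed.

Lemma free_fg n : finitely_generated 'rV[R]_n.
Proof.
apply/finitely_generatedP; exists [seq delta_mx 0 i | i <- enum 'I_n] => S Ss x.
rewrite [x]row_comb; apply: sm_sum => i _; apply/smZ/Ss/map_f.
by rewrite mem_enum.
Qed.

(** Corestricted to its image, [u] becomes onto. *)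
Lemma projective_lift (P U V : lmodType R) (u : {linear U -> V})
    (g : {linear P -> V}) : projective P -> (forall x, exists y, u y = g x) ->
  exists h : {linear P -> U}, forall x, u (h x) = g x.
Proof.
move=> Pp ug; have [u' u'E] : exists u' : {linear U -> smod (im_sm u)},
    forall x, smod_incl (u' x) = u x by apply: smod_corestrict => x; exists x.
have [g' g'E] := smod_corestrict (S := im_sm u) ug.
have [|h hE] := Pp _ _ u' g'; last by exists h => x; rewrite -u'E hE g'E.
move=> y; have [x ux] := smod_inP y; exists x.
by apply: val_inj; rewrite /= u'E.
Qed.
End Submodules.

(** * Graded modules *)

Section GradedModules.
Variables (G : zmodType) (R : pzRingType) (Rdeg : G -> set R).
Hypothesis gR : grading Rdeg.
Hypothesis RdegM : forall tau sigma r s, Rdeg tau r -> Rdeg sigma s ->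
  Rdeg (tau + sigma) (r * s).

Let grG (M : grmod Rdeg) := grmod_grading M.

Lemma gcomp_degree_preserving (M N : grmod Rdeg) (f : {linear M -> N}) sigma x :
  degree_preserving f -> f (gcomp (grG M) x sigma) = gcomp (grG N) (f x) sigma.
Proof.
move=> fdeg; rewrite -[in RHS](add0r sigma); apply/esym/gcomp_shift.
  exact: linear_add.
by move=> tau y /fdeg; rewrite add0r.
Qed.

Section GradedSub.
Variables (M : grmod Rdeg) (S : submodule M).
Hypothesis Sgr : forall x sigma, S x -> S (gcomp (grG M) x sigma).

Definition gr_sub_deg (sigma : G) : set (smod S) :=
  [set x | grmod_deg sigma (smod_incl x)].

Lemma smod_incl_sum (I : Type) (s : seq I) (F : I -> smod S) :
  smod_incl (\sum_(i <- s) F i) = \sum_(i <- s) smod_incl (F i).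
Proof. exact: (morph_add_sum (linear_add (sm_incl S))). Qed.

Lemma gr_sub_grading : grading gr_sub_deg.
Proof.
split.
- by move=> sigma; apply: (grading0 (grG M)).
- by move=> sigma x y; apply: (gradingB (grG M)).
- move=> x; exists (gsupp (grG M) (smod_incl x)).
  exists (fun sigma => smod_in (Sgr sigma (smod_inP x))); split.
    by move=> sigma; apply: (gcomp_deg (grG M)).
  by apply: val_inj; rewrite /= smod_incl_sum; case: (gcompP (grG M) (smod_incl x)).
- move=> s f us fD f0 sigma hs; apply: val_inj => /=.
  apply: (grading_indep (grG M) (f := fun i => smod_incl (f i)) us) => //.
  by rewrite -smod_incl_sum f0.
Qed.

Lemma gr_sub_scale tau sigma r m : Rdeg tau r -> gr_sub_deg sigma m ->
  gr_sub_deg (tau + sigma) (r *: m).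
Proof. exact: grmod_scale. Qed.

Definition gr_sub : grmod Rdeg := Grmod gr_sub_grading gr_sub_scale.
End GradedSub.

Section GradedKernelImage.
Variables (M N : grmod Rdeg) (f : {linear M -> N}).
Hypothesis fdeg : degree_preserving f.

Lemma ker_gr x sigma : ker_sm f x -> ker_sm f (gcomp (grG M) x sigma).
Proof. by rewrite /= gcomp_degree_preserving // => ->; rewrite gcomp0. Qed.

Lemma im_gr x sigma : im_sm f x -> im_sm f (gcomp (grG N) x sigma).
Proof.
move=> [y <-]; exists (gcomp (grG M) y sigma).
exact: gcomp_degree_preserving.
Qed.
End GradedKernelImage.

Lemma fcomp_linear_map (M N : grmod Rdeg) (f : {linear M -> N}) tau :
  linear (fcomp (grG M) (grG N) tau f).
Proof.
have fD := linear_add f; move=> r x y; rewrite fcompD //; congr (_ + _).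
apply: (fcomp_linear _ _ fD _ gR) => [z a b|z a b|a|a|||a z].
- exact: scalerDl.
- exact: scalerDl.
- exact: scalerDr.
- exact: scalerDr.
- by move=> rho sigma a z; apply: grmod_scale.
- by move=> rho sigma a z; apply: grmod_scale.
- exact: linearZ.
Qed.

(** The degree 0 component of a lift is again a lift. *)
Lemma projective_gr_projective (P : grmod Rdeg) : projective P -> gr_projective P.
Proof.
move=> Pp M N f g fdeg gdeg fS; have [h hE] := Pp M N f g fS.
exists (mklinear (fcomp_linear_map h 0)).
  by move=> sigma x Dx; rewrite -[sigma]addr0; apply: (fcomp_deg _ _ (linear_add h)).
apply: (grading_ext (grG P)) => [x y|x y|sigma x Dx]; rewrite ?linearD //=.
rewrite (fcomp_homog _ _ (linear_add h) _ Dx) addr0 gcomp_degree_preserving //.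
by rewrite hE (gcomp_homog _ _ (gdeg _ _ Dx)) eqxx.
Qed.

(** The image of a degree-preserving map is a graded submodule, so the argument
    of [projective_lift] stays inside the graded category. *)
Lemma gr_projective_lift (P U V : grmod Rdeg) (u : {linear U -> V})
    (g : {linear P -> V}) : gr_projective P ->
  degree_preserving u -> degree_preserving g ->
  (forall x, exists y, u y = g x) ->
  exists2 h : {linear P -> U}, degree_preserving h & forall x, u (h x) = g x.
Proof.
move=> Pp udeg gdeg ug.
have [u' u'E] : exists u' : {linear U -> smod (im_sm u)},
    forall x, smod_incl (u' x) = u x by apply: smod_corestrict => x; exists x.
have [g' g'E] := smod_corestrict (S := im_sm u) ug.
have [|||h hdeg hE] := Pp U (gr_sub (im_gr udeg)) u' g'.
- by move=> sigma x Dx; rewrite /= /gr_sub_deg /= u'E; apply: udeg.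
- by move=> sigma x Dx; rewrite /= /gr_sub_deg /= g'E; apply: gdeg.
- move=> y; have [x ux] := smod_inP y; exists x.
  by apply: val_inj; rewrite /= u'E.
by exists h => // x; rewrite -u'E hE g'E.
Qed.

Section GradedFree.
Variables (n : nat) (s : 'I_n -> G).

(** The i-th basis vector has degree [s i]. *)
Definition gr_free_deg (sigma : G) : set 'rV[R]_n :=
  [set x | forall i, Rdeg (sigma - s i) (x 0 i)].

Lemma gr_free_grading : grading gr_free_deg.
Proof.
split.
- by move=> sigma i; rewrite mxE; apply: (grading0 gR).
- by move=> sigma x y Dx Dy i; rewrite !mxE; apply: (gradingB gR).
- move=> x; apply: (grading_span_sums (D := gr_free_deg)).
  + by move=> sigma i; rewrite mxE; apply: (grading0 gR).
  + by move=> sigma u v Du Dv i; rewrite !mxE; apply: (gradingD gR).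
  rewrite [x]row_sum_delta; apply: finite_sums_sum => i.
  move: (x 0 i); apply: (grading_ind gR) => [|a b ha hb|sigma a Da].
  + by rewrite scale0r; apply: finite_sums0.
  + by rewrite scalerDl; apply: finite_sumsD.
  apply: finite_sums1; exists (sigma + s i) => j; rewrite !mxE eqxx /= eq_sym.
  case: eqP => [->|_]; last by rewrite mulr0; apply: (grading0 gR).
  by rewrite addrK mulr1.
- move=> t f ut fD f0 sigma ts; apply/rowP => i; rewrite mxE.
  have injs : injective (fun tau => tau - s i) by apply: addIr.
  have := grading_indep gR (s := map (fun tau => tau - s i) t)
    (f := fun tau => f (tau + s i) 0 i).
  move=> /(_ _ _ _ (sigma - s i)); rewrite subrK; apply.
  + by rewrite map_inj_uniq.
  + by move=> tau; have := fD (tau + s i) i; rewrite addrK.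
  + rewrite big_map (eq_bigr (fun tau => f tau 0 i)) => [|tau _].
      by move/matrixP: f0 => /(_ 0 i); rewrite summxE mxE.
    by rewrite subrK.
  + exact: map_f.
Qed.

Lemma gr_free_scale tau sigma r x : Rdeg tau r -> gr_free_deg sigma x ->
  gr_free_deg (tau + sigma) (r *: x).
Proof. by move=> Dr Dx i; rewrite mxE -addrA; apply: RdegM. Qed.

Definition gr_free : grmod Rdeg := Grmod gr_free_grading gr_free_scale.

Lemma comb_deg (M : grmod Rdeg) (e : 'I_n -> M) :
  (forall i, grmod_deg (s i) (e i)) ->
  degree_preserving (M := gr_free) (mklinear (comb_linear e)).
Proof.
move=> De sigma x Dx; rewrite /= /comb.
apply: (big_ind (grmod_deg sigma)) => [|y z|i _]; first exact: (grading0 (grG M)).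
  exact: (gradingD (grG M)).
by rewrite -[sigma](subrK (s i)); apply: grmod_scale => //; apply: Dx.
Qed.
End GradedFree.

Lemma fg_homogeneous (M : grmod Rdeg) : finitely_generated M ->
  exists n (s : 'I_n -> G) (e : 'I_n -> M),
    (forall i, grmod_deg (s i) (e i)) /\ surjective (comb e).
Proof.
move=> /finitely_generatedP[l lM].
pose L := flatten [seq [seq (sigma, gcomp (grG M) x sigma) |
  sigma <- gsupp (grG M) x] | x <- l].
pose e (i : 'I_(size L)) := (nth (0, 0) L i).2.
exists (size L), (fun i => (nth (0, 0) L i).1), e; split.
  move=> i; rewrite /e; have /flatten_mapP[x _ /mapP[sigma _ ->]] := mem_nth (0, 0) (ltn_ord i).
  exact: gcomp_deg.
suff h m : span_sm e m.
  move=> m; have [c ->] := h m; exists (\row_i c i).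
  by apply: eq_bigr => i _; rewrite mxE.
move: m; apply: lM => x xl; case: (gcompP (grG M) x) => _ _ _ ->.
rewrite big_seq; apply: sm_sum => sigma hs.
have hL : (sigma, gcomp (grG M) x sigma) \in L.
  by apply/flatten_mapP; exists x => //; apply: map_f.
have := hL; rewrite -index_mem => hi.
by have := span_sm_gen e (Ordinal hi); rewrite /e /= nth_index.
Qed.

(** A finitely generated graded module is the image of a graded free module,
    which splits off when the module is projective in the graded category. *)
Lemma gr_projective_projective (P : grmod Rdeg) :
  finitely_generated P -> gr_projective P -> projective P.
Proof.
move=> Pfg Pp; have [n [s [e [De eS]]]] := fg_homogeneous Pfg.
have [|||h _ hE] := Pp (gr_free s) P (mklinear (comb_linear e)) idfun.
- exact: comb_deg.
- by [].
- exact: eS.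
by apply: (projective_retract hE); apply: free_projective.
Qed.

Lemma gr_free_cover (M : grmod Rdeg) : finitely_generated M ->
  exists (F : grmod Rdeg) (p : {linear F -> M}),
    [/\ projective F, finitely_generated F, degree_preserving p & surjective p].
Proof.
move=> /fg_homogeneous[n [s [e [De eS]]]].
exists (gr_free s), (mklinear (comb_linear e)); split.
- exact: free_projective.
- exact: free_fg.
- exact: comb_deg.
- exact: eS.
Qed.
End GradedModules.

(** * Comparison of resolutions *)

(** Chain maps and homotopies are built degree by degree; [Phi] is the invariant
    that makes the next step possible, [Psi] the equation it satisfies. *)
Lemma recursive_choice (T : nat -> Type) (Phi : forall n, T n -> Prop)
    (Psi : forall n, T n -> T n.+1 -> Prop) (t0 : T 0%N) :
  Phi 0%N t0 ->
  (forall n t, Phi n t -> exists2 t', Psi n t t' & Phi n.+1 t') ->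
  exists t : forall n, T n,
    [/\ t 0%N = t0, forall n, Phi n (t n) & forall n, Psi n (t n) (t n.+1)].
Proof.
move=> P0 step.
pose next n (t : {t : T n | Phi n t}) := cid2 (step n (sval t) (svalP t)).
pose t := fix t n : {t : T n | Phi n t} := match n with
  | 0 => exist _ t0 P0
  | m.+1 => exist _ (s2val (next m (t m))) (s2valP' (next m (t m)))
  end.
exists (fun n => sval (t n)); split=> // n; first exact: svalP.
exact: (s2valP (next n (t n))).
Qed.

(** The two categories of modules, graded and ungraded, enter through a type of
    objects with underlying modules and a class of admissible linear maps. *)
Section Comparison.
Variables (R : pzRingType) (Ob : Type) (car : Ob -> lmodType R).
Variable mor : forall X Y : Ob, (car X -> car Y) -> Prop.
Hypothesis mor_id : forall X, @mor X X (fun x => x).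
Hypothesis mor_zero : forall X Y, @mor X Y (fun=> 0).
Hypothesis mor_comp : forall X Y Z (f : car Y -> car Z) (g : car X -> car Y),
  mor f -> mor g -> @mor X Z (fun x => f (g x)).
Hypothesis mor_sub : forall X Y (f g : car X -> car Y),
  mor f -> mor g -> @mor X Y (fun x => f x - g x).

Definition lifting (P : Ob) : Prop :=
  forall (U V : Ob) (u : {linear car U -> car V}) (g : {linear car P -> car V}),
  mor u -> mor g -> (forall x, exists y, u y = g x) ->
  exists2 h : {linear car P -> car U}, mor h & forall x, u (h x) = g x.

(** An augmented resolution; the augmented module sits in degree 0. *)
Record acyclic (C : nat -> Ob) (d : forall n, {linear car (C n.+1) -> car (C n)})
  : Prop := Acyclic {
  acyc_surj : surjective (d 0%N);
  acyc_exact : forall n, exact_at (d n.+1) (d n);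
  acyc_mor : forall n, mor (d n) }.

Section Maps.
Variables (C D : nat -> Ob).
Variables (dC : forall n, {linear car (C n.+1) -> car (C n)}).
Variables (dD : forall n, {linear car (D n.+1) -> car (D n)}).
Hypothesis Clift : forall n, lifting (C n.+1).
Hypotheses (Cac : acyclic dC) (Dac : acyclic dD).

Lemma acyclic_dd n x : dC n (dC n.+1 x) = 0.
Proof. by apply/(acyc_exact Cac); exists x. Qed.

Lemma chain_map_exists (f0 : {linear car (C 0%N) -> car (D 0%N)}) : mor f0 ->
  exists f : forall n, {linear car (C n) -> car (D n)},
    [/\ f 0%N = f0, forall n, mor (f n) &
        forall n x, dD n (f n.+1 x) = f n (dC n x)].
Proof.
move=> f0m.
(* the invariant puts the image of [f n \o dC n] inside that of [dD n]: by
   surjectivity in degree 0, by exactness above *)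
have [||f [f0E fP fd]] := @recursive_choice
  (fun n => {linear car (C n) -> car (D n)})
  (fun n f => mor f /\ forall x, exists y, dD n y = f (dC n x))
  (fun n f f' => forall x, dD n (f' x) = f (dC n x)) f0.
- by split=> // x; have [y yE] := acyc_surj Dac (f0 (dC 0%N x)); exists y.
- move=> n f [fm fd].
  have [||f' f'm f'E] := Clift (u := dD n) (g := (f \o dC n)%FUN) _ _ fd.
  + exact: (acyc_mor Dac).
  + exact: (mor_comp fm (acyc_mor Cac n)).
  exists f' => //; split=> // x.
  by apply/(acyc_exact Dac); rewrite f'E /= acyclic_dd linear0.
by exists f; split=> // n; case: (fP n).
Qed.

Lemma null_homotopy (e : forall n, {linear car (C n) -> car (D n)}) :
  (forall n, mor (e n)) -> (forall x, e 0%N x = 0) ->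
  (forall n x, dD n (e n.+1 x) = e n (dC n x)) ->
  exists s : forall n, {linear car (C n) -> car (D n.+1)},
    [/\ forall x, s 0%N x = 0, forall n, mor (s n) &
        forall n x, e n.+1 x = dD n.+1 (s n.+1 x) + s n (dC n x)].
Proof.
move=> em e0 ed.
have z0 : linear ((fun=> 0) : car (C 0%N) -> car (D 1%N)).
  by move=> r x y; rewrite scaler0 addr0.
(* the invariant says that [e n.+1 - s n \o dC n] consists of cycles *)
have [||s [s0E sP sd]] := @recursive_choice
  (fun n => {linear car (C n) -> car (D n.+1)})
  (fun n s => mor s /\ forall x, dD n (s (dC n x)) = e n (dC n x))
  (fun n s s' => forall x, dD n.+1 (s' x) = e n.+1 x - s (dC n x)) (mklinear z0).
- by split=> [|x]; rewrite /= ?linear0 ?e0 //; apply: mor_zero.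
- move=> n s [sm sd].
  have gL : linear (fun x => e n.+1 x - s (dC n x)).
    by move=> r x y; rewrite !linearP addrACA scalerDr.
  have [||x|s' s'm s'E] := Clift (u := dD n.+1) (g := mklinear gL).
  + exact: (acyc_mor Dac).
  + by apply: mor_sub => //; apply: mor_comp sm (acyc_mor Cac n).
  + by apply/(acyc_exact Dac); rewrite /= linearB ed sd subrr.
  exists s' => //; split=> // x.
  by rewrite s'E /= acyclic_dd linear0 subr0.
exists s; split=> [x|n|n x]; first by rewrite s0E.
  by case: (sP n).
by rewrite sd subrK.
Qed.
End Maps.

(** Homotopy equivalence of two sequences of modules, as needed to compare the
    cohomologies of their duals. *)
Record htpy_equiv (P Q : nat -> Ob)
    (dP : forall n, {linear car (P n.+1) -> car (P n)})
    (dQ : forall n, {linear car (Q n.+1) -> car (Q n)})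
    (f : forall n, {linear car (P n) -> car (Q n)})
    (g : forall n, {linear car (Q n) -> car (P n)})
    (s : forall n, {linear car (P n) -> car (P n.+1)}) : Prop := HtpyEquiv {
  he_morf : forall n, mor (f n);
  he_morh : forall n, mor (s n);
  he_df : forall n x, dQ n (f n.+1 x) = f n (dP n x);
  he_h0 : forall x, g 0%N (f 0%N x) - x = dP 0%N (s 0%N x);
  he_hS : forall n x, g n.+1 (f n.+1 x) - x = dP n.+1 (s n.+1 x) + s n (dP n x) }.

Section Equivalence.
Variables (C D : nat -> Ob).
Variables (dC : forall n, {linear car (C n.+1) -> car (C n)}).
Variables (dD : forall n, {linear car (D n.+1) -> car (D n)}).
Hypotheses (Clift : forall n, lifting (C n.+1)) (Dlift : forall n, lifting (D n.+1)).
Hypotheses (Cac : acyclic dC) (Dac : acyclic dD).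
Variable f : forall n, {linear car (C n) -> car (D n)}.
Variable g : forall n, {linear car (D n) -> car (C n)}.
Hypotheses (fm : forall n, mor (f n)) (gm : forall n, mor (g n)).
Hypothesis fd : forall n x, dD n (f n.+1 x) = f n (dC n x).
Hypothesis gd : forall n x, dC n (g n.+1 x) = g n (dD n x).
Hypothesis gf0 : forall x, g 0%N (f 0%N x) = x.

Lemma acyclic_htpy : exists s : forall n, {linear car (C n.+1) -> car (C n.+2)},
  htpy_equiv (P := fun n => C n.+1) (Q := fun n => D n.+1)
    (fun n => dC n.+1) (fun n => dD n.+1) (fun n => f n.+1) (fun n => g n.+1) s.
Proof.
have eL n : linear (fun x => g n (f n x) - x).
  by move=> r x y; rewrite !linearP addrACA scalerDr.
have [|||s [s0 sm sE]] := @null_homotopy C C dC dC Clift Cac Cac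
  (fun n => mklinear (eL n)).
- by move=> n; apply: mor_sub => //; apply: mor_comp.
- by move=> x; rewrite /= gf0 subrr.
- by move=> n x; rewrite /= linearB gd fd.
exists (fun n => s n.+1); split=> // [x|n x]; last exact: (sE n.+1 x).
by have := sE 0%N x; rewrite /= s0 addr0.
Qed.
End Equivalence.

Lemma htpy_equiv_exists (C D : nat -> Ob)
    (dC : forall n, {linear car (C n.+1) -> car (C n)})
    (dD : forall n, {linear car (D n.+1) -> car (D n)})
    (i : {linear car (C 0%N) -> car (D 0%N)})
    (j : {linear car (D 0%N) -> car (C 0%N)}) :
  (forall n, lifting (C n.+1)) -> (forall n, lifting (D n.+1)) ->
  acyclic dC -> acyclic dD -> mor i -> mor j -> cancel i j -> cancel j i ->
  exists f g s t,
    htpy_equiv (P := fun n => C n.+1) (Q := fun n => D n.+1)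
      (fun n => dC n.+1) (fun n => dD n.+1) f g s /\
    htpy_equiv (P := fun n => D n.+1) (Q := fun n => C n.+1)
      (fun n => dD n.+1) (fun n => dC n.+1) g f t.
Proof.
move=> Cl Dl Cac Dac im jm ij ji.
have [f [f0 fm fd]] := chain_map_exists Cl Cac Dac im.
have [g [g0 gm gd]] := chain_map_exists Dl Dac Cac jm.
have [|s sP] := acyclic_htpy Cl Cac fm gm fd gd; first by move=> x; rewrite f0 g0 ij.
have [|t tP] := acyclic_htpy Dl Dac gm fm gd fd; first by move=> x; rewrite f0 g0 ji.
by exists (fun n => f n.+1), (fun n => g n.+1), s, t.
Qed.
End Comparison.

(** * Finite resolutions and Schanuel's lemma *)

Section FiniteResolutions.
Variable R : pzRingType.

Definition fgp (P : lmodType R) : Prop := projective P /\ finitely_generated P.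

(** Resolutions of length [n] by finitely generated projectives, described
    through one syzygy at a time to suit [schanuel]. *)
Fixpoint fp_dim (n : nat) (M : lmodType R) : Prop :=
  match n with
  | 0 => fgp M
  | m.+1 => exists (K P : lmodType R) (i : {linear K -> P}) (p : {linear P -> M}),
      [/\ fgp P, injective i, surjective p, exact_at i p & fp_dim m K]
  end.

Lemma fgp_prod (P Q : lmodType R) : fgp P -> fgp Q -> fgp (P * Q)%type.
Proof. by move=> [? ?] [? ?]; split; [apply: projective_prod|apply: fg_prod]. Qed.

Lemma fgp_retract (P Q : lmodType R) (i : {linear Q -> P}) (r : {linear P -> Q}) :
  cancel i r -> fgp P -> fgp Q.
Proof.
move=> iK [Pp Pfg]; split; first exact: projective_retract iK Pp.
by apply: fg_image Pfg => y; exists (i y).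
Qed.

Lemma fp_dim_fg n (M : lmodType R) : fp_dim n M -> finitely_generated M.
Proof.
by case: n => [[]//|n] /= [K [P [i [p [[_ Pfg] _ pS _ _]]]]]; apply: fg_image Pfg.
Qed.

Lemma fp_dim_iso n (M N : lmodType R) (f : {linear M -> N}) :
  bijective f -> fp_dim n M -> fp_dim n N.
Proof.
move=> /linear_bij_inv[g fK gK]; case: n => [|n] /=; first exact: fgp_retract gK.
move=> [K [P [i [p [Pfgp iI pS ip Kn]]]]].
exists K, P, i, (f \o p)%FUN; split=> // [y|y].
  by have [x xE] := pS (g y); exists x; rewrite /= xE gK.
rewrite -ip /=; split=> [/(congr1 g)|->]; first by rewrite fK linear0.
exact: linear0.
Qed.

Lemma fp_dim_prod n (M Q : lmodType R) :
  fgp Q -> fp_dim n M -> fp_dim n (M * Q)%type.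
Proof.
case: n => [Qf Mf|n] /=; first exact: fgp_prod.
move=> Qf [K [P [i [p [Pfgp iI pS ip Kn]]]]].
have iL : linear (fun k => (i k, 0) : P * Q).
  by move=> r x y; rewrite linearP; congr pair; rewrite /= scaler0 addr0.
have pL : linear (fun u : P * Q => (p u.1, u.2) : M * Q).
  by move=> r x y; rewrite /= linearP.
exists K, (P * Q)%type, (mklinear iL), (mklinear pL); split=> //.
- exact: fgp_prod.
- by move=> x y [/iI].
- by move=> [m q]; have [x <-] := pS m; exists (x, q).
- move=> [x q] /=; split=> [[/ip[k <-] ->]|[k [<- <-]]]; first by exists k.
  by congr pair; apply/ip; exists k.
Qed.

(** Both sides are isomorphic to the pullback of [p] and [q]. *)
Lemma schanuel (M K P Q : lmodType R) (i : {linear K -> P}) (p : {linear P -> M})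
    (q : {linear Q -> M}) :
  projective P -> projective Q -> injective i -> surjective p -> exact_at i p ->
  surjective q ->
  exists f : {linear (K * Q)%type -> (smod (ker_sm q) * P)%type}, bijective f.
Proof.
move=> Pp Qp iI pS ip qS.
(* [(k, y)] stands for the point [(i k + b y, y)] of the pullback, and [(l, x)]
   for the point [(x, l + a x)] *)
have [a aE] := Pp _ _ q p qS; have [b bE] := Qp _ _ p q pS.
have pi k : p (i k) = 0 by apply/ip; exists k.
pose x (u : K * Q) := i u.1 + b u.2.
have xL : linear x by move=> r u v; rewrite /x /= !linearP scalerDr addrACA.
have kerP u : ker_sm q (u.2 - a (x u)).
  by rewrite /= linearB aE linearD pi add0r bE subrr.
have fL : linear (fun u => (smod_in (kerP u), x u)).
  move=> r u v; congr pair; last exact: xL.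
  by apply: val_inj; rewrite /= xL linearP opprD scalerBr addrACA.
exists (mklinear fL).
have fI : injective (mklinear fL).
  move=> [k y] [k' y'] /= [+ xE].
  move: xE; rewrite /x /= => xE; rewrite xE => /addIr yE.
  by move: xE; rewrite yE => /addIr /iI ->.
have fS u : exists v, mklinear fL v = u.
  move: u => [l y]; pose y' := smod_incl l + a y.
  have /ip[k kE] : p (y - b y') = 0.
    by rewrite linearB bE linearD aE (smod_inP l) add0r subrr.
  have xE : x (k, y') = y by rewrite /x /= kE subrK.
  exists (k, y'); congr pair => //.
  by apply: val_inj; rewrite /= xE addrK.
have [g gE] := choice fS.
by exists g => // v; apply: fI; rewrite gE.
Qed.

(** The shifted resolution resolves the kernel of the augmentation. *)
Lemma resolution_fp_dim n (M : lmodType R) (P : resolution M) :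
  (forall i, fgp (P i)) -> (forall i, (n < i)%N -> forall x : P i, x = 0) ->
  fp_dim n M.
Proof.
elim: n M P => [|n IHn] M P Pf P0.
  apply: (fp_dim_iso (n := 0) (f := @res_aug _ _ P)) (Pf 0%N).
  have augI : injective (@res_aug _ _ P).
    move=> x y xy; apply/eqP; rewrite -subr_eq0; apply/eqP.
    have [z <-] : exists z, res_diff P 0%N z = x - y.
      by apply/(@res_exact0 _ _ P); rewrite linearB xy subrr.
    by rewrite (P0 1%N _ z) ?linear0.
  have [g gE] := choice (@res_aug_surj _ _ P).
  by exists g => // x; apply: augI; rewrite gE.
pose K := ker_sm (res_aug P).
have dK x : K (res_diff P 0%N x) by apply/(@res_exact0 _ _ P); exists x.
have [a aE] := smod_corestrict dK.
exists (smod K), (P 0%N), (sm_incl K), (res_aug P); split=> //.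
- exact: sm_incl_inj.
- exact: res_aug_surj.
- move=> y; split=> [y0|[x <-]]; last exact: (smod_inP x).
  by exists (smod_in (S := K) y0).
have aS : surjective a.
  move=> y; have /(@res_exact0 _ _ P)[x xE] := smod_inP y.
  by exists x; apply: val_inj; rewrite /= aE.
have aex : exact_at (res_diff P 1%N) a.
  move=> y; rewrite -(@res_exactS _ _ P); split=> [/(congr1 (@smod_incl _ _ _))|y0].
    by rewrite aE.
  by apply: val_inj; rewrite /= aE y0.
apply: (IHn (smod K) (Resolution (res_mod := fun i => P i.+1) aS aex
  (fun i => @res_exactS _ _ P i.+1))) => i; first exact: Pf.
by move=> hi; apply: P0.
Qed.

Section GradedResolution.
Variables (G : zmodType) (Rdeg : G -> set R).
Hypothesis gR : grading Rdeg.
Hypothesis RdegM : forall tau sigma r s, Rdeg tau r -> Rdeg sigma s ->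
  Rdeg (tau + sigma) (r * s).

Definition gr_zero : grmod Rdeg.
Proof.
apply: (@Grmod G R Rdeg 'rV[R]_0 (fun=> setT)) => //; split=> //.
  by move=> x; exists [::], (fun=> 0); split=> //; rewrite big_nil; apply/rowP => -[].
by move=> *; apply/rowP => -[].
Defined.

Lemma gr_zeroP (x : gr_zero) : x = 0.
Proof. by apply/rowP => -[]. Qed.

Definition fg_gr_resolution (M : grmod Rdeg) : Prop :=
  exists P : gr_resolution M,
    (forall i, gr_projective (P i) /\ finitely_generated (P i)) /\
    finite_length (fun i => P i).

Lemma fg_gr_resolution0 (M : grmod Rdeg) : fgp M -> fg_gr_resolution M.
Proof.
move=> [Mp Mfg].
pose P i : grmod Rdeg := if i is _.+1 then gr_zero else M.
have dL i : linear ((fun=> 0) : P i.+1 -> P i).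
  by move=> r x y; rewrite scaler0 addr0.
pose d i : {linear P i.+1 -> P i} := mklinear (dL i).
have ex0 : exact_at (d 0%N) (idfun : {linear M -> M}).
  by move=> y; split=> [y0|[x <-]//]; exists 0; apply/esym.
have exS i : exact_at (d i.+1) (d i).
  by move=> y; split=> // _; exists 0; rewrite /= [RHS]gr_zeroP.
exists (@GrResolution _ _ _ M P d idfun
  (fun i sigma m _ => grading0 (grmod_grading (P i)) sigma)
  (fun sigma m Dm => Dm) (fun y => ex_intro _ y erefl) ex0 exS).
split; last by exists 0%N => -[|i] // _ x; apply: gr_zeroP.
case=> [|i]; split=> //; first exact: projective_gr_projective.
  exact/(projective_gr_projective gR)/free_projective.
exact: free_fg.
Qed.

(** Splicing a resolution of the kernel of a cover. *)
Lemma fg_gr_resolutionS (M F : grmod Rdeg) (p : {linear F -> M})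
    (pdeg : degree_preserving p) :
  fgp F -> surjective p ->
  fg_gr_resolution (gr_sub (ker_gr pdeg)) -> fg_gr_resolution M.
Proof.
move=> [Fp Ffg] pS [Q [Qf [n Q0]]].
pose P i : grmod Rdeg := if i is j.+1 then Q j else F.
pose d i : {linear P i.+1 -> P i} := match i with
  | 0 => (sm_incl (ker_sm p) \o gres_aug Q)%FUN
  | j.+1 => gres_diff Q j
  end.
have ddeg i : degree_preserving (d i).
  case: i => [|i] /=; last exact: gres_diff_deg.
  by move=> sigma m /(@gres_aug_deg _ _ _ _ Q).
have ex0 : exact_at (d 0%N) p.
  move=> y; split=> [y0|[x <-]]; last exact: (smod_inP (gres_aug Q x)).
  have [x xE] := @gres_aug_surj _ _ _ _ Q (smod_in (S := ker_sm p) y0).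
  by exists x; rewrite /= xE.
have exS i : exact_at (d i.+1) (d i).
  case: i => [|i] /= y; last exact: gres_exactS.
  rewrite -(@gres_exact0 _ _ _ _ Q); split=> [y0|y0].
    exact: val_inj.
  by rewrite [LHS](congr1 (@smod_incl _ _ _) y0).
exists (@GrResolution _ _ _ M P d p ddeg pdeg pS ex0 exS); split.
  by case=> [|i] /=; [split=> //; apply: projective_gr_projective|apply: Qf].
by exists n.+1 => -[|i] // hi x; apply: Q0.
Qed.

(** A summand [Q] keeps track of the error made in Schanuel's lemma. *)
Lemma fp_dim_gr_resolution n (M : grmod Rdeg) (Q : lmodType R) :
  fgp Q -> fp_dim n (M * Q)%type -> fg_gr_resolution M.
Proof.
have fstL (U V : lmodType R) : linear (fst : U * V -> U) by [].
have fstS (U V : lmodType R) : surjective (mklinear (fstL U V)).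
  by move=> x; exists (x, 0).
elim: n M Q => [|n IHn] M Q Qf MQ.
  apply: fg_gr_resolution0.
  have inlL : linear (fun m : M => (m, 0) : M * Q).
    by move=> r x y; congr pair; rewrite /= scaler0 addr0.
  by apply: (@fgp_retract (M * Q)%type _ (mklinear inlL) (mklinear (fstL M Q))).
have [F [p [Fp Ffg pdeg pS]]] :=
  gr_free_cover gR RdegM (fg_image (fstS M Q) (fp_dim_fg MQ)).
apply: (fg_gr_resolutionS (pdeg := pdeg)) => //.
move: MQ => /= [K [P [i [r [[Pp Pfg] iI rS ir Kn]]]]].
have [Qp Qfg] := Qf.
have qL : linear (fun u : F * Q => (p u.1, u.2) : M * Q).
  by move=> a x y; rewrite /= linearP.
have qS : surjective (mklinear qL).
  by move=> [m y]; have [x xE] := pS m; exists (x, y); rewrite /= xE.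
have [f fB] := schanuel Pp (projective_prod Fp Qp) iI rS ir qS.
have Ln := fp_dim_iso fB (fp_dim_prod (fgp_prod (conj Fp Ffg) Qf) Kn).
(* the kernels of [p] and of [p] times the identity of [Q] agree *)
have kerE (l : smod (ker_sm (mklinear qL))) : ker_sm p (smod_incl l).1.
  by have [] := smod_inP l.
have hL : linear (fun u : smod (ker_sm (mklinear qL)) * P =>
    (smod_in (kerE u.1), u.2) : smod (ker_sm p) * P).
  by move=> a u v; congr pair; apply: val_inj.
apply: (IHn _ P) => //; apply: (fp_dim_iso (f := mklinear hL)) Ln.
have kerP (l : smod (ker_sm p)) : ker_sm (mklinear qL) (smod_incl l, 0).
  by rewrite /= (smod_inP l).
exists (fun u => (smod_in (kerP u.1), u.2)) => [[l y]|[l y]] /=.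
  congr pair; apply: val_inj => /=; case: l (smod_inP l) => -[x z] /= _.
  by case=> _ ->.
by congr pair; apply: val_inj.
Qed.
End GradedResolution.
End FiniteResolutions.

(** * The grading of the enveloping algebra *)

Section EnvGrading.
Variables (k : fieldType) (G : zmodType) (A : graded_kalgebra k G).
Notation gA := (galg_grading A).

Let scalM_comp c (b : A) sigma :
  gcomp gA (kalg_scal A c * b) sigma = kalg_scal A c * gcomp gA b sigma.
Proof.
rewrite -{1}[sigma]add0r; apply: (gcomp_shift gA gA (L := fun b => kalg_scal A c * b)).
  by move=> x y; rewrite mulrDr.
by move=> tau x Dx; rewrite add0r; apply: galg_scal.
Qed.

(** The sum over sigma of the tensors of [a_sigma] and [b_(gamma - sigma)]. *)
Let proj_pure (gamma : G) (a b : A) : env A :=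
  gext gA (fun sigma a' => env_pure a' (gcomp gA b (gamma - sigma))) a.

Let proj_pure_Dl gamma (b : A) :
  {morph (fun a => proj_pure gamma a b) : x y / x + y}.
Proof. by apply: gextD => sigma x y; apply: env_pureDl. Qed.

Let proj_pure_homog gamma sigma (a b : A) : galg_deg sigma a ->
  proj_pure gamma a b = env_pure a (gcomp gA b (gamma - sigma)).
Proof. by apply: (gext_homog gA) => tau x y; apply: env_pureDl. Qed.

Let proj_pure_balanced gamma :
  balanced (fun a c => a * kalg_scal A c) (fun c a => kalg_scal A c * a)
    (proj_pure gamma).
Proof.
split=> [b a a'|a b b'|a c b]; first exact: proj_pure_Dl.
- move: a; apply: (grading_ext gA) => [||sigma a Da]; first exact: proj_pure_Dl.
    by move=> x y; rewrite !proj_pure_Dl addrACA.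
  by rewrite !(proj_pure_homog _ _ Da) gcompD env_pureDr.
- move: a; apply: (grading_ext gA) => [x y||sigma a Da].
  + by rewrite mulrDl proj_pure_Dl.
  + exact: proj_pure_Dl.
  have Dac : galg_deg sigma (a * kalg_scal A c).
    by rewrite -kalg_scalC; apply: galg_scal.
  rewrite (proj_pure_homog _ _ Dac) (proj_pure_homog _ _ Da) env_pure_scal.
  by rewrite scalM_comp.
Qed.

Let env_proj gamma (x : env A) : env A := tens_lift (proj_pure gamma) x.

Let env_projD gamma : {morph env_proj gamma : x y / x + y}.
Proof. by move=> x y; rewrite [LHS]tens_liftD. Qed.

Let env_pure0r (a : A) : env_pure a 0 = 0.
Proof. exact: (morph_add0 (env_pureDr a)). Qed.

Let env_proj_homog gamma sigma x : env_deg sigma x ->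
  env_proj gamma x = if gamma == sigma then x else 0.
Proof.
move: x; apply: (finite_sumsP
    (D := fun x => env_proj gamma x = if gamma == sigma then x else 0)).
- by rewrite (morph_add0 (env_projD gamma)) if_same.
- by move=> x y xE yE; rewrite env_projD xE yE; case: eqP; rewrite ?addr0.
move=> _ [rho [tau [a [b [Da Db <- ->]]]]].
rewrite [LHS]tens_lift_pure // (proj_pure_homog _ _ Da) (gcomp_homog _ _ Db).
by rewrite subr_eq [tau + rho]addrC; case: eqP => // _; apply: env_pure0r.
Qed.

(** Independence comes from projections onto the components, defined on the
    tensor product by those of the two factors. *)
Lemma env_grading : grading (@env_deg k G A).
Proof.
split.
- by move=> sigma; apply: finite_sums0.
- by move=> sigma x y Dx Dy; apply: finite_sumsD => //; apply: env_degN.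
- move=> x; apply: (grading_span_sums (D := @env_deg k G A)).
  + by move=> sigma; apply: finite_sums0.
  + by move=> sigma u v; apply: finite_sumsD.
  elim/tens_ind: x => [|a b x IHx]; first exact: finite_sums0.
  apply: finite_sumsD IHx; rewrite -/(env_pure a b).
  move: a; apply: (grading_ind gA) => [|a a' ha ha'|sigma a Da].
  + by rewrite (morph_add0 (env_pureDl b)); apply: finite_sums0.
  + by rewrite env_pureDl; apply: finite_sumsD.
  move: b; apply: (grading_ind gA) => [|b b' hb hb'|tau b Db].
  + by rewrite env_pure0r; apply: finite_sums0.
  + by rewrite env_pureDr; apply: finite_sumsD.
  by apply: finite_sums1; exists (sigma + tau); apply: finite_sums1; exists sigma, tau, a, b.
- move=> s f us fD f0 sigma hs.
  have := congr1 (env_proj sigma) f0.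
  rewrite (morph_add_sum (env_projD sigma)) (morph_add0 (env_projD sigma)).
  under eq_bigr => tau _ do rewrite (env_proj_homog _ (fD tau)).
  rewrite (@sum_support _ _ _ [:: sigma]) //.
  + by rewrite big_seq1 eqxx.
  + by move=> i; rewrite inE => /eqP ->.
  + by move=> i; rewrite inE eq_sym => /negPf ->.
Qed.

Lemma env_degM tau sigma (x y : env A) :
  env_deg tau x -> env_deg sigma y -> env_deg (tau + sigma) (x * y).
Proof.
move=> + Dy; move: x; apply: (finite_sumsP
  (D := fun x => env_deg (tau + sigma) (x * y))).
- by rewrite mul0r; apply: finite_sums0.
- by move=> x x' hx hx'; rewrite mulrDl; apply: finite_sumsD.
move=> _ [s [t [a [b [Da Db <- ->]]]]].
move: y Dy; apply: (finite_sumsP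
  (D := fun y => env_deg (s + t + sigma) (env_pure a b * y))).
- by rewrite mulr0; apply: finite_sums0.
- by move=> x x' hx hx'; rewrite mulrDr; apply: finite_sumsD.
move=> _ [s' [t' [a' [b' [Da' Db' <- ->]]]]]; rewrite env_pureM.
apply: finite_sums1; exists (s + s'), (t' + t), (a * a'), (b' * b).
by split=> //; [exact: galg_mul|exact: galg_mul|rewrite [t' + t]addrC addrACA].
Qed.

(** * Homogeneous components of functionals *)

Section Functionals.
Variable P : grmod (@env_deg k G A).
Notation gP := (grmod_grading P).

Definition hcomp (tau : G) (f : P -> env A) : fun_bimod A P :=
  fcomp gP env_grading tau f.

Lemma hcomp_hom_deg tau (f : P -> env A) : is_hom f -> hom_deg tau (hcomp tau f).
Proof.
move=> [fD fZ]; split; last by move=> sigma x; apply: (fcomp_deg gP _ fD).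
split; first exact: (fcompD gP _ fD).
apply: (fcomp_linear _ _ fD _ env_grading (aM := *:%R) (aN := *%R)) => //.
- by move=> x a b; apply: scalerDl.
- by move=> x a b; apply: mulrDl.
- by move=> a x y; apply: scalerDr.
- by move=> a x y; apply: mulrDr.
- by move=> rho sigma a x; apply: grmod_scale.
- by move=> rho sigma a x; apply: env_degM.
Qed.

Lemma hcomp_homog rho tau (f : fun_bimod A P) : hom_deg rho f ->
  hcomp tau f = if tau == rho then f else 0.
Proof.
move=> [[fD _] fdeg]; apply/funext => x.
by rewrite /hcomp (fcomp_of_homog _ _ fD _ fdeg); case: eqP.
Qed.

Lemma hcomp_sum tau (I : Type) (s : seq I) (F : I -> fun_bimod A P) :
  (forall i, is_hom (F i)) ->
  hcomp tau (\sum_(i <- s) F i) = \sum_(i <- s) hcomp tau (F i).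
Proof.
move=> FL; have sumD t : {morph (\sum_(i <- t) F i : fun_bimod A P) : x y / x + y}.
  elim: t => [|i t IHt] x y; first by rewrite big_nil addr0.
  by rewrite big_cons -![(F i + _) _]/(F i _ + _) (FL i).1 IHt addrACA.
apply/funext; elim: s => [|i s IHs] x.
  rewrite !big_nil /hcomp (@fcomp_of_homog _ _ _ _ _ gP env_grading _ _ tau).
  - by rewrite if_same.
  - by move=> u v; rewrite addr0.
  - by move=> sigma u _; apply: (grading0 env_grading).
rewrite !big_cons -[RHS]/(_ x + _ x) -IHs; apply: fcomp_add => //.
exact: (FL i).1.
Qed.

Lemma sum_homog_comp (s : seq G) (F : G -> fun_bimod A P) tau :
  uniq s -> tau \in s -> (forall sigma, hom_deg sigma (F sigma)) ->
  hcomp tau (\sum_(sigma <- s) F sigma) = F tau.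
Proof.
move=> us hs FD; rewrite hcomp_sum; last by move=> i; case: (FD i).
under eq_bigr => sigma _ do rewrite (hcomp_homog _ (FD sigma)).
rewrite (@sum_support _ _ _ [:: tau]) //.
- by rewrite big_seq1 eqxx.
- by move=> i; rewrite inE => /eqP ->.
- by move=> i; rewrite inE eq_sym => /negPf ->.
Qed.

(** The components of a finite sum of homogeneous functionals vanish outside the
    degrees of the summands. *)
Lemma gr_hom_finite (f : fun_bimod A P) : gr_hom f ->
  exists2 t : seq G, uniq t & f = \sum_(tau <- t) hcomp tau f.
Proof.
move=> [l [lD fE]].
have fE' : f = \sum_(i < size l) l`_i by rewrite fE (big_nth 0) big_mkord.
have /choice [deg degP] : forall i : 'I_(size l), exists tau, hom_deg tau l`_i.
  by move=> i; apply/lD/mem_nth.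
exists (undup [seq deg i | i <- enum 'I_(size l)]); first exact: undup_uniq.
have hE tau : hcomp tau f =
    \sum_(i < size l) (if tau == deg i then l`_i else 0 : fun_bimod A P).
  rewrite fE' hcomp_sum; last by move=> i; case: (degP i).
  by apply: eq_bigr => i _; apply: hcomp_homog.
rewrite (eq_bigr _ (fun tau _ => hE tau)).
rewrite exchange_big {1}fE'; apply: eq_bigr => i _.
rewrite (@sum_support _ _ _ [:: deg i]) ?undup_uniq ?big_seq1 ?eqxx //.
- by move=> j; rewrite inE mem_undup => /eqP ->; rewrite map_f ?mem_enum.
- by move=> j; rewrite inE => /negPf ->.
Qed.

(** On a finitely generated module every functional has finitely many
    components, so the graded dual is the whole dual. *)
Lemma fg_gr_hom (f : fun_bimod A P) :
  finitely_generated P -> is_hom f -> gr_hom f.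
Proof.
move=> /finitely_generatedP[s sP] fL; have [fD fZ] := fL.
have [t ut tE] := fcomp_finite_seq gP env_grading fD s.
suff -> : f = \sum_(tau <- t) hcomp tau f.
  apply: finite_sums_sum => tau; apply: finite_sums1; exists tau.
  exact: hcomp_hom_deg.
have sumE x : (\sum_(tau <- t) hcomp tau f : fun_bimod A P) x =
    \sum_(tau <- t) hcomp tau f x.
  by elim: t {ut tE} => [|i t IHt]; rewrite ?big_nil // !big_cons -IHt.
have eqL r x y : \sum_(tau <- t) hcomp tau f x = f x ->
    \sum_(tau <- t) hcomp tau f y = f y ->
    \sum_(tau <- t) hcomp tau f (r *: x + y) = f (r *: x + y).
  move=> xE yE; rewrite fD fZ -xE -yE mulr_sumr -big_split.
  apply: eq_bigr => tau _; have [[hD hZ] _] := hcomp_hom_deg tau fL.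
  by rewrite hD hZ.
have eq0 : \sum_(tau <- t) hcomp tau f 0 = f 0.
  rewrite (morph_add0 fD) big1 // => tau _.
  by have [[hD hZ] _] := hcomp_hom_deg tau fL; apply: morph_add0.
apply/funext => x; rewrite sumE; apply/esym; move: x.
exact: (sP (@Submodule _ P [set x | \sum_(tau <- t) hcomp tau f x = f x] eq0 eqL)).
Qed.
End Functionals.

Lemma hcomp_precomp (P Q : grmod (@env_deg k G A)) (h : {linear P -> Q}) tau
    (f : Q -> env A) : is_hom f -> degree_preserving h ->
  forall x, hcomp tau (fun y : P => f (h y)) x = hcomp tau f (h x).
Proof. by move=> [fD _] hdeg; apply: fcomp_precomp => //; apply: linear_add. Qed.

Lemma hom_deg_precomp (P Q : grmod (@env_deg k G A)) (h : {linear P -> Q}) tau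
    (f : fun_bimod A Q) : degree_preserving h ->
  hom_deg tau f -> @hom_deg k G A P tau (fun x => f (h x)).
Proof.
move=> hdeg [[fD fZ] fdeg]; split; first split=> [x y|r x].
- by rewrite linearD fD.
- by rewrite linearZ fZ.
by move=> sigma x /hdeg/fdeg.
Qed.

Lemma gr_hom_precomp (P Q : grmod (@env_deg k G A)) (h : {linear P -> Q})
    (f : fun_bimod A Q) : degree_preserving h ->
  gr_hom f -> @gr_hom k G A P (fun x => f (h x)).
Proof.
move=> hdeg; move: f; apply: (finite_sumsP (D := fun f : fun_bimod A Q =>
  @gr_hom k G A P (fun x => f (h x)))).
- exact: finite_sums0.
- by move=> f g fH gH; apply: finite_sumsD fH gH.
- move=> f [tau fD]; apply: finite_sums1; exists tau.
  exact: hom_deg_precomp.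
Qed.
End EnvGrading.

(** * Comparing cohomology bimodules *)

(** Maps that are mutually inverse up to coboundaries induce an isomorphism; its
    value on classes is recorded to follow degrees. *)
Section SubquotIso.
Variables (k : fieldType) (A : kalgebra k) (X Y : bimod A).
Variables (ZX BX : subbimod X) (ZY BY : subbimod Y).
Variables (phi : X -> Y) (psi : Y -> X).
Hypothesis phiD : {morph phi : x y / x + y}.
Hypothesis phil : forall a x, phi (lact a x) = lact a (phi x).
Hypothesis phir : forall x a, phi (ract x a) = ract (phi x) a.
Hypothesis phiZ : forall x, sb_set ZX x -> sb_set ZY (phi x).
Hypothesis phiB : forall x, sb_set BX x -> sb_set BY (phi x).
Hypothesis psiD : {morph psi : x y / x + y}.
Hypothesis psiZ : forall y, sb_set ZY y -> sb_set ZX (psi y).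
Hypothesis psiB : forall y, sb_set BY y -> sb_set BX (psi y).
Hypothesis psiphi : forall x, sb_set ZX x -> sb_set BX (psi (phi x) - x).
Hypothesis phipsi : forall y, sb_set ZY y -> sb_set BY (phi (psi y) - y).

Lemma subquot_iso : exists F : subquot ZX BX -> subquot ZY BY,
  is_bimod_iso F /\ forall (z : sub_bimod ZX) (h : sb_set ZY (phi (sub_val z))),
    F (subquot_class BX z) = subquot_class BY (sub_mk h).
Proof.
pose phi' (z : sub_bimod ZX) : sub_bimod ZY := sub_mk (phiZ (sub_valP z)).
pose psi' (z : sub_bimod ZY) : sub_bimod ZX := sub_mk (psiZ (sub_valP z)).
pose F (q : subquot ZX BX) : subquot ZY BY := subquot_class BY (phi' (repr q)).
pose E (q : subquot ZY BY) : subquot ZX BX := subquot_class BX (psi' (repr q)).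
have FE z : F (subquot_class BX z) = subquot_class BY (phi' z).
  apply/quot_classP; have /phiB := quot_repr (sub_restrict ZX BX) z.
  by rewrite /= (morph_addB phiD).
have EE z : E (subquot_class BY z) = subquot_class BX (psi' z).
  apply/quot_classP; have /psiB := quot_repr (sub_restrict ZY BY) z.
  by rewrite /= (morph_addB psiD).
exists F; split; last first.
  by move=> z h; rewrite FE; congr (subquot_class BY _); apply: val_inj.
split.
- exists E => q; have [z ->] := quot_class_ex q.
    by rewrite FE EE; apply/quot_classP; apply/psiphi/sub_valP.
  by rewrite EE FE; apply/quot_classP; apply/phipsi/sub_valP.
- move=> q r; have [z ->] := quot_class_ex q; have [w ->] := quot_class_ex r.
  rewrite -quot_classD !FE -quot_classD; congr (subquot_class BY _).
  by apply: val_inj; apply: phiD.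
- move=> a q; have [z ->] := quot_class_ex q.
  rewrite [lact a _]quot_lactE !FE [RHS]quot_lactE; congr (subquot_class BY _).
  by apply: val_inj; apply: phil.
- move=> q a; have [z ->] := quot_class_ex q.
  rewrite [ract _ a]quot_ractE !FE [RHS]quot_ractE; congr (subquot_class BY _).
  by apply: val_inj; apply: phir.
Qed.
End SubquotIso.

Section DualCohomology.
Variables (k : fieldType) (A : kalgebra k) (Ob : Type).
Variables (car : Ob -> lmodType (env A)).
Variable mor : forall X Y : Ob, (car X -> car Y) -> Prop.
Variable H : forall X : Ob, set (fun_bimod A (car X)).
Hypothesis H_hom : forall X f, @H X f -> is_hom f.
Hypothesis H_precomp : forall X Y (h : {linear car X -> car Y}) f,
  mor h -> @H Y f -> @H X (fun x => f (h x)).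

Definition dual_cocycle (P : nat -> Ob)
    (d : forall n, {linear car (P n.+1) -> car (P n)}) (i : nat) :
    set (fun_bimod A (car (P i))) :=
  [set f | H f /\ forall x, f (d i x) = 0].

Definition dual_coboundary (P : nat -> Ob)
    (d : forall n, {linear car (P n.+1) -> car (P n)}) (i : nat) :
    set (fun_bimod A (car (P i))) :=
  match i with
  | 0 => [set f | f = 0]
  | j.+1 => [set f | exists2 g : car (P j) -> env A, @H (P j) g &
                       f = fun x => g (d j x)]
  end.

Section Maps.
Variables (P Q : nat -> Ob).
Variables (dP : forall n, {linear car (P n.+1) -> car (P n)}).
Variables (dQ : forall n, {linear car (Q n.+1) -> car (Q n)}).
Variables (f : forall n, {linear car (P n) -> car (Q n)}).
Variables (g : forall n, {linear car (Q n) -> car (P n)}).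
Variables (s : forall n, {linear car (P n) -> car (P n.+1)}).
Hypothesis fgs : htpy_equiv mor dP dQ f g s.

Lemma precomp_cocycle i z :
  dual_cocycle dQ (i := i) z -> dual_cocycle dP (i := i) (fun x => z (f i x)).
Proof.
move=> [zH zd]; split; first by apply: H_precomp zH; apply: (he_morf fgs).
by move=> x; rewrite -(he_df fgs) zd.
Qed.

Lemma precomp_coboundary i z :
  dual_coboundary dQ (i := i) z -> dual_coboundary dP (i := i) (fun x => z (f i x)).
Proof.
case: i z => [|i] z /= => [->//|[w wH ->]].
exists (fun x => w (f i x)); first by apply: H_precomp wH; apply: (he_morf fgs).
by apply/funext => x; rewrite (he_df fgs).
Qed.

(** A cocycle kills the part of the homotopy formula that starts with a
    differential; the other part is a coboundary. *)
Lemma precomp_homotopic i (z : fun_bimod A (car (P i))) :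
  dual_cocycle dP (i := i) z ->
  dual_coboundary dP (i := i) ((fun x => z (g i (f i x))) - z : fun_bimod A _).
Proof.
move=> [zH zd]; have [zD _] := H_hom zH.
case: i z zH zd zD => [|i] z zH zd zD /=.
  apply/funext => x; rewrite -[LHS]/(z _ - z x) -(morph_addB zD) (he_h0 fgs).
  exact: zd.
exists (fun x => z (s i x)); first by apply: H_precomp zH; apply: (he_morh fgs).
apply/funext => x; rewrite -[LHS]/(z _ - z x) -(morph_addB zD) (he_hS fgs) zD.
by rewrite zd add0r.
Qed.
End Maps.

(** The cocycles and coboundaries are given up to equivalence, so that both the
    graded and the ungraded ones are instances. *)
Lemma dual_cohomology_iso (P Q : nat -> Ob)
    (dP : forall n, {linear car (P n.+1) -> car (P n)})
    (dQ : forall n, {linear car (Q n.+1) -> car (Q n)}) f g s t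
    (i : nat) (ZP BP : subbimod (fun_bimod A (car (P i))))
    (ZQ BQ : subbimod (fun_bimod A (car (Q i)))) :
  htpy_equiv mor dP dQ f g s -> htpy_equiv mor dQ dP g f t ->
  (forall z, sb_set ZP z <-> dual_cocycle dP (i := i) z) ->
  (forall z, sb_set BP z <-> dual_coboundary dP (i := i) z) ->
  (forall z, sb_set ZQ z <-> dual_cocycle dQ (i := i) z) ->
  (forall z, sb_set BQ z <-> dual_coboundary dQ (i := i) z) ->
  exists F : subquot ZQ BQ -> subquot ZP BP,
    is_bimod_iso F /\
    forall (z : sub_bimod ZQ) (h : sb_set ZP (fun x => sub_val z (f i x))),
      F (subquot_class BQ z) = subquot_class BP (sub_mk h).
Proof.
move=> fgs gft ZPE BPE ZQE BQE.
apply: (subquot_iso (phi := fun z : fun_bimod A (car (Q i)) =>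
    (fun x => z (f i x)) : fun_bimod A (car (P i)))
  (psi := fun z : fun_bimod A (car (P i)) =>
    (fun x => z (g i x)) : fun_bimod A (car (Q i)))) => //.
- by move=> z /ZQE hz; apply/ZPE/(precomp_cocycle fgs).
- by move=> z /BQE hz; apply/BPE/(precomp_coboundary fgs).
- by move=> z /ZPE hz; apply/ZQE/(precomp_cocycle gft).
- by move=> z /BPE hz; apply/BQE/(precomp_coboundary gft).
- by move=> z /ZQE hz; apply/BQE/(precomp_homotopic gft).
- by move=> z /ZPE hz; apply/BPE/(precomp_homotopic fgs).
Qed.
End DualCohomology.

(** * The grading of graded cohomology *)

Section CohomologyGrading.
Variables (k : fieldType) (G : zmodType) (A : graded_kalgebra k G).
Variables (P : nat -> grmod (@env_deg k G A)).
Variable d : forall n, {linear P n.+1 -> P n}.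
Hypothesis ddeg : forall n, degree_preserving (d n).
Variable i : nat.
Notation Z := (gr_cocycles d i).
Notation B := (gr_coboundaries d i).
Notation Deg := (@gr_cohomology_deg k G A P d i).

Lemma hom_deg0 tau : @hom_deg k G A (P i) tau (0 : fun_bimod A (P i)).
Proof.
by split=> [|sigma x _]; [apply: is_hom0|apply: (grading0 (env_grading A))].
Qed.

Lemma hom_degB tau (f g : fun_bimod A (P i)) :
  hom_deg tau f -> hom_deg tau g -> hom_deg tau (f - g).
Proof.
move=> [fL fdeg] [gL gdeg]; split=> [|sigma x Dx]; first exact: is_homB.
exact: (gradingB (env_grading A) (fdeg _ _ Dx) (gdeg _ _ Dx)).
Qed.

Lemma hcomp_cocycle tau (z : fun_bimod A (P i)) :
  gr_cocycle d (i := i) z -> gr_cocycle d (i := i) (hcomp tau z).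
Proof.
move=> [zH zd]; have zL := gr_hom_is_hom zH; split.
  by apply: finite_sums1; exists tau; apply: hcomp_hom_deg.
move=> x; rewrite -(hcomp_precomp tau zL (@ddeg i)).
rewrite (_ : (fun y => z (d i y)) = (0 : fun_bimod A _)); last first.
  by apply/funext => y; apply: zd.
have : @hom_deg k G A (P i.+1) (tau + 0) (0 : fun_bimod A _).
  by split=> [|sigma y _]; [apply: is_hom0|apply: (grading0 (env_grading A))].
by move=> h; rewrite (hcomp_homog tau h) if_same.
Qed.

Lemma homog_coboundary (s : seq G) (f : G -> fun_bimod A (P i)) tau :
  uniq s -> tau \in s -> (forall sigma, hom_deg sigma (f sigma)) ->
  gr_coboundary d (i := i) (\sum_(sigma <- s) f sigma) ->
  gr_coboundary d (i := i) (f tau).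
Proof.
move=> us hs fD; rewrite -(sum_homog_comp us hs fD).
case: i f fD => [|j] f fD /=.
  move=> ->; have h : @hom_deg k G A (P 0%N) (tau + 0) (0 : fun_bimod A _).
    by split=> [|sigma y _]; [apply: is_hom0|apply: (grading0 (env_grading A))].
  by rewrite (hcomp_homog tau h) if_same.
move=> [g gH ->]; have gL := gr_hom_is_hom gH.
exists (hcomp tau g).
  by apply: finite_sums1; exists tau; apply: hcomp_hom_deg.
by apply/funext => x; apply: hcomp_precomp.
Qed.

Lemma quot_class0 (X : bimod A) (S : subbimod X) : quot_class S 0 = 0.
Proof. exact: (morph_add0 (@quot_classD _ _ _ S)). Qed.

Lemma sub_val_sum (X : bimod A) (S : subbimod X) (I : Type) (s : seq I)
    (F : I -> sub_bimod S) :
  sub_val (\sum_(j <- s) F j) = \sum_(j <- s) sub_val (F j).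
Proof. by apply: (morph_add_sum (f := @sub_val k A X S)). Qed.

(** The components of a cocycle are cocycles and those of a coboundary are
    coboundaries, so the grading of functionals descends to the quotient. *)
Lemma gr_cohomology_grading : grading Deg.
Proof.
split.
- move=> sigma; exists 0; first exact: hom_deg0.
  by rewrite /subquot_class quot_class0.
- move=> sigma _ _ [z zD ->] [w wD ->]; exists (z - w); first exact: hom_degB.
  by rewrite /subquot_class (morph_addB (@quot_classD _ _ _ _)).
- move=> x; have [z ->] := quot_class_ex x.
  have [zH zd] := sub_valP z.
  have [t ut tE] := gr_hom_finite zH.
  pose c tau : sub_bimod Z := sub_mk (Z := Z) (hcomp_cocycle tau (conj zH zd)).
  exists t, (fun tau => subquot_class B (c tau)); split.
    by move=> tau; exists (c tau) => //; apply/hcomp_hom_deg/gr_hom_is_hom.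
  rewrite -(morph_add_sum (@quot_classD _ _ _ _)); congr (quot_class _ _).
  by apply: val_inj; rewrite [RHS]sub_val_sum [LHS]tE.
- move=> s f us fD f0 tau hs.
  have /choice [c cP] : forall sigma, exists z : sub_bimod Z,
      hom_deg sigma (sub_val z) /\ f sigma = subquot_class B z.
    by move=> sigma; have [z zD zE] := fD sigma; exists z.
  rewrite (cP tau).2 -(quot_class0 (sub_restrict Z B)); apply/quot_classP.
  rewrite subr0; apply: (homog_coboundary (f := fun sigma => sub_val (c sigma)) us hs).
    by move=> sigma; case: (cP sigma).
  rewrite -sub_val_sum.
  have : quot_class (sub_restrict Z B) (\sum_(sigma <- s) c sigma) =
      quot_class (sub_restrict Z B) 0.
    rewrite quot_class0 (morph_add_sum (@quot_classD _ _ _ _)) -[RHS]f0.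
    by apply: eq_bigr => sigma _; rewrite (cP sigma).2.
  by move/quot_classP; rewrite subr0.
Qed.

Lemma gr_cohomology_lact tau sigma (a : A) m : galg_deg tau a ->
  Deg sigma m -> Deg (tau + sigma) (lact a m).
Proof.
move=> Da [z zD ->]; exists (lact a z); last by rewrite [LHS]quot_lactE.
have [zL zdeg] := zD; split=> [|rho x Dx]; first exact: is_homM.
by rewrite [tau + _]addrC addrA; apply: env_degMr => //; apply: zdeg.
Qed.

Lemma gr_cohomology_ract sigma tau m (a : A) : Deg sigma m ->
  galg_deg tau a -> Deg (sigma + tau) (ract m a).
Proof.
move=> [z zD ->] Da; exists (ract z a); last by rewrite [LHS]quot_ractE.
have [zL zdeg] := zD; split=> [|rho x Dx]; first exact: is_homM.
by rewrite addrA; apply: env_degMl => //; apply: zdeg.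
Qed.

Definition gr_cohomology_grbimod : grbimod A :=
  Grbimod gr_cohomology_grading gr_cohomology_lact gr_cohomology_ract.
End CohomologyGrading.

(** * Invertible bimodules *)

Section BimodIso.
Variables (k : fieldType) (A : kalgebra k).
Implicit Types U V W : bimod A.

Lemma is_bimod_iso_inv U V (f : U -> V) : is_bimod_iso f ->
  exists g, [/\ is_bimod_iso g, cancel f g & cancel g f].
Proof.
move=> [[g fK gK] fD fl fr]; exists g; split=> //; split.
- by exists f.
- by move=> x y; apply: (can_inj fK); rewrite fD !gK.
- by move=> a x; apply: (can_inj fK); rewrite fl !gK.
- by move=> x a; apply: (can_inj fK); rewrite fr !gK.
Qed.

Lemma is_bimod_iso_comp U V W (f : U -> V) (g : V -> W) :
  is_bimod_iso f -> is_bimod_iso g -> is_bimod_iso (fun x => g (f x)).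
Proof.
move=> [fB fD fl fr] [gB gD gl gr]; split.
- exact: (bij_comp gB fB).
- by move=> x y; rewrite fD gD.
- by move=> a x; rewrite fl gl.
- by move=> x a; rewrite fr gr.
Qed.

Lemma bimod_iso_sym U V : bimod_iso U V -> bimod_iso V U.
Proof. by move=> [f /is_bimod_iso_inv[g [gI _ _]]]; exists g. Qed.

Lemma bimod_iso_trans U V W : bimod_iso U V -> bimod_iso V W -> bimod_iso U W.
Proof.
by move=> [f fI] [g gI]; exists (fun x => g (f x)); apply: is_bimod_iso_comp.
Qed.

Lemma bimod_iso_zero U V : bimod_iso U V -> bimod_zero U -> bimod_zero V.
Proof.
move=> [f [[g fK gK] fD _ _]] U0 v.
by rewrite -(gK v) (U0 (g v)) (morph_add0 fD).
Qed.

Lemma is_bimod_iso_id U : is_bimod_iso (fun x : U => x).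
Proof. by split=> //; exists id. Qed.

Lemma tpure_act U V (u : U) a (v : V) : tpure (ract u a) v = tpure u (lact a v).
Proof. exact: pure_bal. Qed.

Section TensorMap.
Variables (U V U' V' : bimod A) (f : U -> U') (g : V -> V').
Hypotheses (fI : is_bimod_iso f) (gI : is_bimod_iso g).

Definition tens_map (x : tensor_bimod U V) : tensor_bimod U' V' :=
  tens_lift (fun u v => tpure (f u) (g v)) x.

Lemma tens_map_bal : balanced (@ract k A U) (@lact k A V)
  (fun u v => tpure (f u) (g v)).
Proof.
have [[_ fD _ fr] [_ gD gl _]] := (fI, gI); split=> [v u u'|u v v'|u c v].
- by rewrite fD [LHS]pureDl.
- by rewrite gD [LHS]pureDr.
- by rewrite fr gl tpure_act.
Qed.

Lemma tens_mapE u v : tens_map (tpure u v) = tpure (f u) (g v).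
Proof. exact: (tens_lift_pure tens_map_bal). Qed.

Lemma tens_mapD : {morph tens_map : x y / x + y}.
Proof. exact: (tens_liftD tens_map_bal). Qed.
End TensorMap.

Lemma tens_map_iso U V U' V' (f : U -> U') (g : V -> V') :
  is_bimod_iso f -> is_bimod_iso g -> is_bimod_iso (tens_map f g).
Proof.
move=> fI gI; have [f' [fI' fK fK']] := is_bimod_iso_inv fI.
have [g' [gI' gK gK']] := is_bimod_iso_inv gI.
have [_ fD fl fr] := fI; have [_ gD gl gr] := gI.
split; last 1 first.
- move=> x a; move: x; apply: tens_ext => [x y|x y|u v].
  + by rewrite ractDl tens_mapD.
  + by rewrite tens_mapD // ractDl.
  by rewrite [ract _ a]tens_ractE !tens_mapE // [RHS]tens_ractE gr.
- exists (tens_map f' g'); apply: tens_ext => [x y|//|u v].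
  + by rewrite !tens_mapD.
  + by rewrite -/(tpure u v) !tens_mapE // fK gK.
  + by rewrite !tens_mapD.
  + by rewrite -/(tpure u v) !tens_mapE // fK' gK'.
- exact: tens_mapD.
- move=> a; apply: tens_ext => [x y|x y|u v].
  + by rewrite lactDr tens_mapD.
  + by rewrite tens_mapD // lactDr.
  by rewrite [lact a _]tens_lactE !tens_mapE // [RHS]tens_lactE fl.
Qed.

Lemma invertible_iso U U' : bimod_iso U U' ->
  invertible_bimod U' -> invertible_bimod U.
Proof.
move=> [f fI] [V [[a aI] [b bI]]]; exists V; split.
  exists (fun x => a (tens_map f id x)); apply: is_bimod_iso_comp aI.
  by apply: tens_map_iso => //; apply: is_bimod_iso_id.
exists (fun x => b (tens_map id f x)); apply: is_bimod_iso_comp bI.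
by apply: tens_map_iso => //; apply: is_bimod_iso_id.
Qed.
End BimodIso.

Section PureIso.
Variables (k : fieldType) (A : kalgebra k) (U V : bimod A).
Variable alpha : tensor_bimod U V -> regular_bimod A.
Hypothesis alphaI : is_bimod_iso alpha.

Definition pairing (u : U) (v : V) : A := alpha (tpure u v).

Lemma pairingDl v : {morph pairing^~ v : x y / x + y}.
Proof.
by case: alphaI => _ aD _ _ x y; rewrite /pairing -aD; congr alpha; apply: pureDl.
Qed.

Lemma pairingDr u : {morph pairing u : x y / x + y}.
Proof.
by case: alphaI => _ aD _ _ x y; rewrite /pairing -aD; congr alpha; apply: pureDr.
Qed.

Lemma pairing_bal u c v : pairing (ract u c) v = pairing u (lact c v).
Proof. by rewrite /pairing tpure_act. Qed.

Lemma pairing_lact c u v : pairing (lact c u) v = c * pairing u v.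
Proof.
by case: alphaI => _ _ al _; rewrite -[RHS]al; congr alpha; rewrite [RHS]tens_lactE.
Qed.

Lemma pairing_ract c u v : pairing u (ract v c) = pairing u v * c.
Proof.
by case: alphaI => _ _ _ ar; rewrite -[RHS]ar; congr alpha; rewrite [RHS]tens_ractE.
Qed.

Lemma pairing_span c : exists l : seq (U * V), c = \sum_(p <- l) pairing p.1 p.2.
Proof.
have [[a' _ aK] aD _ _] := alphaI; have [l lE] := tens_class_ex (a' c).
by exists l; rewrite -[LHS]aK lE tens_class_sum (morph_add_sum aD).
Qed.

(** By injectivity of [alpha] the two tensors are equal already. *)
Lemma pairing_eq (W : zmodType) (h : U -> V -> W) (l : seq (U * V)) u v :
  balanced (@ract k A U) (@lact k A V) h ->
  \sum_(p <- l) pairing p.1 p.2 = pairing u v ->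
  \sum_(p <- l) h p.1 p.2 = h u v.
Proof.
move=> hB; have [[a' aK _] aD _ _] := alphaI.
rewrite -(morph_add_sum aD l (fun p => tpure p.1 p.2)).
move=> /(can_inj aK) /(congr1 (tens_lift h)).
rewrite (tens_lift_pure hB) (morph_add_sum (tens_liftD hB)) => <-.
by apply: eq_bigr => p _; rewrite (tens_lift_pure hB).
Qed.
End PureIso.

Section Compatible.
Variables (k : fieldType) (A : kalgebra k).
Implicit Types U V : bimod A.

Lemma lact_add U (a : A) : {morph (@lact k A U a) : x y / x + y}.
Proof. by move=> x y; rewrite lactDr. Qed.
Lemma ract_add U (a : A) : {morph ((@ract k A U)^~ a) : x y / x + y}.
Proof. by move=> x y; rewrite ractDl. Qed.
Lemma lact_addl U (u : U) : {morph (fun a => lact a u) : x y / x + y}.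
Proof. by move=> x y; rewrite lactDl. Qed.
Lemma ract_addr U (u : U) : {morph ract u : x y / x + y}.
Proof. by move=> x y; rewrite ractDr. Qed.

Definition compatible U V (a : U -> V -> A) (b : V -> U -> A) : Prop :=
  forall u v u', lact (a u v) u' = ract u (b v u').

(** The two contractions of [U (x) V (x) U] onto [U] are isomorphisms, so they
    differ by an automorphism of [U]; absorbing it in the second isomorphism
    makes them equal. *)
Lemma invertible_compatible U : invertible_bimod U ->
  exists (V : bimod A) (alpha : tensor_bimod U V -> regular_bimod A)
    (beta : tensor_bimod V U -> regular_bimod A),
    [/\ is_bimod_iso alpha, is_bimod_iso beta &
        compatible (pairing alpha) (pairing beta)].
Proof.
move=> [V [[alpha aI] [beta bI]]].
set a := pairing alpha; set b := pairing beta.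
have [l lE] := pairing_span aI 1; have [m mE] := pairing_span bI 1.
(* [theta] sends the contraction by [b] to the contraction by [a], and [theta']
   goes back *)
pose theta u := \sum_(p <- m) lact (a u p.1) p.2.
pose theta' u := \sum_(p <- l) ract p.1 (b p.2 u).
have aDl v : {morph a^~ v : x y / x + y} by apply: pairingDl.
have aDr u : {morph a u : x y / x + y} by apply: pairingDr.
have bDl v : {morph b^~ v : x y / x + y} by apply: pairingDl.
have bDr u : {morph b u : x y / x + y} by apply: pairingDr.
have a_lact c u v : a (lact c u) v = c * a u v by apply: pairing_lact.
have a_ract c u v : a u (ract v c) = a u v * c by apply: pairing_ract.
have b_lact c u v : b (lact c u) v = c * b u v by apply: pairing_lact.
have b_ract c u v : b u (ract v c) = b u v * c by apply: pairing_ract.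
have a_bal u c v : a (ract u c) v = a u (lact c v) by apply: pairing_bal.
have b_bal v c u : b (ract v c) u = b v (lact c u) by apply: pairing_bal.
have thetaD : {morph theta : x y / x + y}.
  move=> x y; rewrite -big_split; apply: eq_bigr => p _.
  by rewrite aDl lactDl.
have theta_lact c u : theta (lact c u) = lact c (theta u).
  rewrite (morph_add_sum (lact_add c)); apply: eq_bigr => p _.
  by rewrite a_lact lactA.
have thetaE u v u' : theta (ract u (b v u')) = lact (a u v) u'.
  rewrite /theta -(pairing_eq bI (h := fun v u' => lact (a u v) u')
    (l := [seq (lact (b v u') p.1, p.2) | p <- m])).
  - by rewrite big_map; apply: eq_bigr => p _; rewrite [a _ _]pairing_bal.
  - split=> [w x y|x w w'|x c w]; [by rewrite aDr lactDl|by rewrite lactDr|].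
    by rewrite a_ract lactA.
  - rewrite big_map -[RHS]mulr1 mE mulr_sumr; apply: eq_bigr => p _.
    exact: (pairing_lact bI).
have theta'E u v u' : theta' (lact (a u v) u') = ract u (b v u').
  rewrite /theta' -(pairing_eq aI (h := fun u v => ract u (b v u'))
    (l := [seq (p.1, ract p.2 (a u v)) | p <- l])).
  - by rewrite big_map; apply: eq_bigr => p _; rewrite -[b _ _]pairing_bal.
  - split=> [w x y|x w w'|x c w]; [by rewrite ractDl|by rewrite bDl ractDr|].
    by rewrite b_lact ractA.
  - rewrite big_map -[RHS]mul1r lE mulr_suml; apply: eq_bigr => p _.
    exact: (pairing_ract aI).
have theta'D : {morph theta' : x y / x + y}.
  move=> x y; rewrite -big_split; apply: eq_bigr => p _.
  by rewrite bDr ractDr.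
have thetaK : cancel theta theta'.
  move=> u; rewrite (morph_add_sum theta'D) -[RHS]ract1 mE.
  by rewrite (morph_add_sum (ract_addr u)); apply: eq_bigr => p _; rewrite theta'E.
have theta'K : cancel theta' theta.
  move=> u; rewrite (morph_add_sum thetaD) -[RHS]lact1 lE.
  by rewrite (morph_add_sum (lact_addl u)); apply: eq_bigr => p _; rewrite thetaE.
have thetaI : is_bimod_iso theta.
  split=> // [|u c]; first by exists theta'.
  rewrite -[u]ract1 mE (morph_add_sum (ract_addr u)).
  rewrite (morph_add_sum (ract_add c)) !(morph_add_sum thetaD).
  rewrite (morph_add_sum (ract_add c)); apply: eq_bigr => p _.
  by rewrite ractA -b_ract !thetaE lractA.
exists V, alpha, (fun x => beta (tens_map id theta x)); split=> //.
  by apply: is_bimod_iso_comp bI; apply: tens_map_iso => //; apply: is_bimod_iso_id.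
move=> u v u'; rewrite /pairing tens_mapE //; last exact: is_bimod_iso_id.
by rewrite -/(b _ _) -theta'E -theta_lact thetaK.
Qed.
End Compatible.

Section GradedInvertible.
Variables (k : fieldType) (G : zmodType) (A : graded_kalgebra k G).
Notation gA := (galg_grading A).

Lemma tensor_deg_span (U V : grbimod A) (x : tensor_bimod U V) :
  exists (s : seq G) (f : G -> tensor_bimod U V),
    (forall sigma, @tensor_deg k G A U V sigma (f sigma)) /\
    x = \sum_(sigma <- s) f sigma.
Proof.
apply: (grading_span_sums (D := @tensor_deg k G A U V)).
- by move=> sigma; apply: finite_sums0.
- by move=> sigma y z; apply: finite_sumsD.
elim/tens_ind: x => [|u v x IHx]; first exact: finite_sums0.
apply: finite_sumsD IHx; rewrite -/(tpure u v).
have pDl w : {morph (fun u => tpure u w : tensor_bimod U V) : x y / x + y}.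
  by move=> y z; apply: pureDl.
have pDr w : {morph (fun v => tpure w v : tensor_bimod U V) : x y / x + y}.
  by move=> y z; apply: pureDr.
move: u; apply: (grading_ind (grbimod_grading U)) => [|u u' hu hu'|sigma u Du].
- by rewrite (morph_add0 (pDl v)); apply: finite_sums0.
- by rewrite pDl; apply: finite_sumsD.
move: v; apply: (grading_ind (grbimod_grading V)) => [|v v' hv hv'|tau v Dv].
- by rewrite (morph_add0 (pDr u)); apply: finite_sums0.
- by rewrite pDr; apply: finite_sumsD.
apply: finite_sums1; exists (sigma + tau); apply: finite_sums1.
by exists sigma, tau, u, v.
Qed.

Lemma pairing_gr_iso (U V : grbimod A) (alpha : tensor_bimod U V -> regular_bimod A) :
  is_bimod_iso alpha ->
  (forall tau sigma u v, @grbimod_deg _ _ _ U tau u -> @grbimod_deg _ _ _ V sigma v ->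
    galg_deg (tau + sigma) (pairing alpha u v)) ->
  gr_bimod_iso (@tensor_deg k G A U V) (@grbimod_deg _ _ _ (gr_regular_bimod A)).
Proof.
move=> aI adeg; exists alpha; split=> //; have [aB aD _ _] := aI.
apply: (degree_reflect gA) => //.
- exact: tensor_deg_span.
- by move=> sigma; apply: finite_sums0.
- by move=> sigma x y; apply: finite_sumsD.
- exact: bij_inj.
move=> sigma; apply: (finite_sumsP (D := fun x => galg_deg sigma (alpha x))).
- by rewrite (morph_add0 aD); apply: (grading0 gA).
- by move=> x y hx hy; rewrite aD; apply: (gradingD gA).
- by move=> _ [tau [rho [u [v [Du Dv <- ->]]]]]; apply: adeg.
Qed.

Section Inverse.
Variables (U : grbimod A) (V : bimod A).
Variables (alpha : tensor_bimod U V -> regular_bimod A)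
  (beta : tensor_bimod V U -> regular_bimod A).
Hypotheses (aI : is_bimod_iso alpha) (bI : is_bimod_iso beta).
Hypothesis ab : compatible (pairing alpha) (pairing beta).
Notation a := (pairing alpha).
Notation b := (pairing beta).
Notation gU := (grbimod_grading U).

Let pair_nondeg v : (forall u, a u v = 0) -> v = 0.
Proof.
move=> av; have [m mE] := pairing_span bI 1.
rewrite -(lact1 v) mE (morph_add_sum (lact_addl v)) big1 // => p _.
have hB : balanced (@ract k A U) (@lact k A V) (fun u v => lact (b p.1 u) v).
  split=> [w x y|x w w'|x c w]; [by rewrite pairingDr // lactDl|by rewrite lactDr|].
  by rewrite pairing_ract // lactA.
have := pairing_eq aI (l := [::]) (u := p.2) (v := v) hB.
by rewrite !big_nil av => /(_ erefl) <-.
Qed.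

Let ract_faithful (c : A) : (forall u : U, ract u c = 0) -> c = 0.
Proof.
move=> Uc; have [m mE] := pairing_span bI 1.
rewrite -(mul1r c) mE mulr_suml big1 // => p _.
by rewrite -pairing_ract // Uc; apply: (morph_add0 (pairingDr bI p.1)).
Qed.

(** The pairing identifies [V] with the left dual of [U], and these are the
    degrees of functionals. *)
Definition inverse_deg (tau : G) : set V :=
  [set v | forall sigma u, @grbimod_deg _ _ _ U sigma u -> galg_deg (sigma + tau) (a u v)].

(** The compatibility of the pairings provides a finite dual basis, through
    which the homogeneous components of a functional are again represented by
    elements of [V]. *)
Lemma inverse_deg_span v : exists (s : seq G) (f : G -> V),
  (forall tau, inverse_deg tau (f tau)) /\ v = \sum_(tau <- s) f tau.
Proof.
have [m mE] := pairing_span bI 1.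
have basis u : u = \sum_(p <- m) lact (a u p.1) p.2.
  rewrite -[LHS]ract1 mE (morph_add_sum (ract_addr u)).
  by apply: eq_bigr => p _; rewrite ab.
have aDl w : {morph a^~ w : x y / x + y} by apply: pairingDl.
have aDr u : {morph a u : x y / x + y} by apply: pairingDr.
pose phi tau : U -> A := fcomp gU gA tau (a^~ v).
have phiL tau c u : phi tau (lact c u) = c * phi tau u.
  apply: (fcomp_linear gU gA (aDl v) tau gA (aM := @lact k A U) (aN := *%R)).
  - exact: lact_addl.
  - by move=> x y z; rewrite mulrDl.
  - exact: lact_add.
  - by move=> x y z; rewrite mulrDr.
  - by move=> rho sigma c' x; apply: grbimod_lact.
  - by move=> rho sigma c' x; apply: galg_mul.
  - by move=> c' x; apply: pairing_lact.
have phiD tau : {morph phi tau : x y / x + y} by apply: fcompD.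
pose vc tau := \sum_(p <- m) ract p.1 (phi tau p.2).
have vcE tau u : a u (vc tau) = phi tau u.
  rewrite (morph_add_sum (aDr u)) [in RHS](basis u) (morph_add_sum (phiD tau)).
  by apply: eq_bigr => p _; rewrite phiL pairing_ract.
have [t _ tE] := fcomp_finite_seq gU gA (aDl v) (map snd m).
exists t, vc; split.
  by move=> tau sigma u Du; rewrite vcE; apply: (fcomp_deg _ _ (aDl v)).
apply/eqP; rewrite -subr_eq0; apply/eqP/pair_nondeg => u.
rewrite (morph_addB (aDr u)) (morph_add_sum (aDr u)).
rewrite (eq_bigr _ (fun tau _ => vcE tau u)).
suff -> : \sum_(tau <- t) phi tau u = a u v by rewrite subrr.
transitivity (\sum_(p <- m) a u p.1 * a p.2 v).
  rewrite [in LHS](basis u).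
  rewrite (eq_bigr _ (fun tau _ => morph_add_sum (phiD tau) _ _)) exchange_big.
  apply: eq_big_seq => p pm; rewrite (eq_bigr _ (fun tau _ => phiL tau _ _)).
  by rewrite -mulr_sumr tE // map_f.
rewrite [in RHS](basis u) (morph_add_sum (aDl v)).
by apply: eq_bigr => p _; rewrite pairing_lact.
Qed.

Lemma inverse_grading : grading inverse_deg.
Proof.
have aDr u : {morph a u : x y / x + y} by apply: pairingDr.
split.
- by move=> tau sigma u _; rewrite (morph_add0 (aDr u)); apply: (grading0 gA).
- move=> tau x y Dx Dy sigma u Du; rewrite (morph_addB (aDr u)).
  by apply: (gradingB gA); [apply: Dx|apply: Dy].
- exact: inverse_deg_span.
- move=> s f us fD f0 tau hs; apply: pair_nondeg.
  apply: (grading_ext gU) => [x y|x y|sigma u Du]; first exact: pairingDl.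
    by rewrite addr0.
  have shiftI : injective (fun x => x - sigma) by apply: addIr.
  have addI : injective (fun x => sigma + x) by apply: addrI.
  have := grading_indep gA (s := [seq sigma + i | i <- s])
    (f := fun i => a u (f (i - sigma))) _ _ _ (map_f _ hs).
  rewrite addrAC subrr add0r; apply.
  + by rewrite map_inj_uniq.
  + by move=> i; have := fD (i - sigma) _ _ Du; rewrite addrCA subrr addr0.
  rewrite big_map -[RHS](morph_add0 (aDr u)) -f0 (morph_add_sum (aDr u)).
  by apply: eq_bigr => i _; rewrite addrAC subrr add0r.
Qed.

Lemma inverse_lact tau sigma (c : A) v : galg_deg tau c -> inverse_deg sigma v ->
  inverse_deg (tau + sigma) (lact c v).
Proof.
move=> Dc Dv rho u Du; rewrite -pairing_bal addrA.
by apply: Dv; apply: grbimod_ract.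
Qed.

Lemma inverse_ract sigma tau v (c : A) : inverse_deg sigma v -> galg_deg tau c ->
  inverse_deg (sigma + tau) (ract v c).
Proof.
by move=> Dv Dc rho u Du; rewrite pairing_ract // addrA; apply: galg_mul => //; apply: Dv.
Qed.

Definition gr_inverse : grbimod A :=
  Grbimod inverse_grading inverse_lact inverse_ract.

(** By compatibility [b v u] acts on [U] from the right as a map of degree
    tau + sigma, and [U] is faithful. *)
Lemma beta_deg tau sigma v u : inverse_deg tau v -> @grbimod_deg _ _ _ U sigma u ->
  galg_deg (tau + sigma) (b v u).
Proof.
move=> Dv Du; suff -> : b v u = gcomp gA (b v u) (tau + sigma) by apply: gcomp_deg.
apply/eqP; rewrite -subr_eq0; apply/eqP/ract_faithful => w.
rewrite (morph_addB (ract_addr w)); apply/eqP; rewrite subr_eq0; apply/eqP.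
move: w; apply: (grading_ext gU) => [x y|x y|rho w Dw]; rewrite ?ractDl //.
rewrite -(gcomp_shift gA gU (L := ract w) (rho := rho)); last first.
- by move=> i c Dc; apply: grbimod_ract.
- exact: ract_addr.
rewrite -(ab w v u) (@gcomp_homog _ _ _ gU (rho + (tau + sigma))) ?eqxx //.
by rewrite addrA; apply: grbimod_lact => //; apply: Dv.
Qed.

Lemma inverse_gr_invertible : gr_invertible_bimod U.
Proof.
exists gr_inverse; split.
  by apply: (@pairing_gr_iso U gr_inverse alpha) => // tau sigma u v Du; apply.
exact: (@pairing_gr_iso gr_inverse U beta bI beta_deg).
Qed.
End Inverse.

Lemma invertible_gr_invertible (U : grbimod A) :
  invertible_bimod U -> gr_invertible_bimod U.
Proof.
by move=> /invertible_compatible[V [alpha [beta [aI bI ab]]]];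
  apply: inverse_gr_invertible ab.
Qed.

Lemma gr_invertible_invertible (U : grbimod A) :
  gr_invertible_bimod U -> invertible_bimod U.
Proof.
by move=> [V [[f [fI _]] [g [gI _]]]]; exists V; split; [exists f|exists g].
Qed.
End GradedInvertible.

(** * Independence of the resolution *)

(** The augmentation is treated as a further differential, so that chain maps
    start from the identity of the resolved module. *)
Section Augmented.
Variables (R : pzRingType) (Ob : Type) (car : Ob -> lmodType R).
Variables (M : Ob) (P : nat -> Ob).
Variable d : forall n, {linear car (P n.+1) -> car (P n)}.
Variable e : {linear car (P 0%N) -> car M}.

Definition aug_ob (n : nat) : Ob := if n is m.+1 then P m else M.

Definition aug_diff (n : nat) : {linear car (aug_ob n.+1) -> car (aug_ob n)} :=
  match n with 0 => e | m.+1 => d m end.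
End Augmented.

Section ExtIndependence.
Variables (k : fieldType) (G : zmodType) (A : graded_kalgebra k G).
Notation E := (@env_deg k G A).

Lemma Ext_iso (M : lmodType (env A)) (P Q : resolution M) (i : nat) :
  (forall n, projective (P n)) -> (forall n, projective (Q n)) ->
  bimod_iso (Ext Q i) (Ext P i).
Proof.
move=> Pp Qp.
pose mor (X Y : lmodType (env A)) (f : X -> Y) := True.
have lift X : projective X -> lifting (car := id) mor X.
  by move=> Xp U V u g _ _ /(projective_lift Xp)[h hE]; exists h.
have ac (S : resolution M) :
    acyclic (car := id) mor (aug_diff (car := id) (res_diff S) (res_aug S)).
  split=> [|n|//]; first exact: res_aug_surj.
  by case: n => [|n]; [apply: res_exact0|apply: res_exactS].
have [||||||||f [g [s [t [fgs gft]]]]] := @htpy_equiv_exists _ _ id mor _ _ _ _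
  (aug_ob M P) (aug_ob M Q) _ _ idfun idfun
  (fun n => lift _ (Pp n)) (fun n => lift _ (Qp n)) (ac P) (ac Q) => //.
have Hpre (X Y : lmodType (env A)) (h : {linear X -> Y}) (z : fun_bimod A Y) :
    mor X Y h -> is_hom z -> @is_hom k A X (fun x => z (h x)).
  by move=> _ [zD zZ]; split=> [x y|r x]; rewrite ?linearD ?linearZ ?zD ?zZ.
have [F [FI _]] := @dual_cohomology_iso _ A _ id mor (fun X => @is_hom k A X)
  (fun X f fL => fL) Hpre P Q _ _ f g s t i
  (cocycles (@res_diff _ _ P) i) (coboundaries (@res_diff _ _ P) i)
  (cocycles (@res_diff _ _ Q) i) (coboundaries (@res_diff _ _ Q) i) fgs gft
  (fun=> iff_refl _) (fun=> iff_refl _) (fun=> iff_refl _) (fun=> iff_refl _).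
by exists F.
Qed.

Lemma gr_Ext_iso (M : grmod E) (P Q : gr_resolution M) (i : nat) :
  (forall n, gr_projective (P n)) -> (forall n, gr_projective (Q n)) ->
  gr_bimod_iso (@gr_Ext_deg _ _ _ M Q i) (@gr_Ext_deg _ _ _ M P i).
Proof.
move=> Pp Qp.
pose car : grmod E -> lmodType (env A) := @grmod_car G (env A) E.
pose mor (X Y : grmod E) (f : X -> Y) := degree_preserving f.
have lift X : gr_projective X -> lifting (car := car) mor X.
  by move=> Xp U V u g udeg gdeg; apply: gr_projective_lift.
have ac (S : gr_resolution M) :
    acyclic (car := car) mor (aug_diff (car := car) (gres_diff S) (gres_aug S)).
  split=> [|n|n]; first exact: gres_aug_surj.
    by case: n => [|n]; [apply: gres_exact0|apply: gres_exactS].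
  by case: n => [|n]; [apply: gres_aug_deg|apply: gres_diff_deg].
have [||||||||f [g [s [t [fgs gft]]]]] := @htpy_equiv_exists _ _ car mor _ _ _ _
  (aug_ob M P) (aug_ob M Q) _ _ idfun idfun
  (fun n => lift _ (Pp n)) (fun n => lift _ (Qp n)) (ac P) (ac Q) => //.
- by move=> X sigma m.
- by move=> X Y sigma m _; apply: (grading0 (grmod_grading Y)).
- by move=> X Y Z u v udeg vdeg sigma m /vdeg/udeg.
- move=> X Y u v udeg vdeg sigma m Dm.
  by apply: (gradingB (grmod_grading Y)); [apply: udeg|apply: vdeg].
have Hpre (X Y : grmod E) (h : {linear X -> Y}) (z : fun_bimod A Y) :
    mor X Y h -> gr_hom z -> @gr_hom k G A X (fun x => z (h x)).
  by move=> hdeg; apply: gr_hom_precomp.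
have [F [FI FE]] := @dual_cohomology_iso _ A _ car mor (fun X => @gr_hom k G A X)
  (fun X z => @gr_hom_is_hom k G A X z) Hpre P Q _ _ f g s t i
  (gr_cocycles (@gres_diff _ _ _ _ P) i) (gr_coboundaries (@gres_diff _ _ _ _ P) i)
  (gr_cocycles (@gres_diff _ _ _ _ Q) i) (gr_coboundaries (@gres_diff _ _ _ _ Q) i)
  fgs gft
  (fun=> iff_refl _) (fun=> iff_refl _) (fun=> iff_refl _) (fun=> iff_refl _).
exists F; split=> //; have [FB FD _ _] := FI.
have grP := gr_cohomology_grading (@gres_diff_deg _ _ _ _ P) i.
have grQ := gr_cohomology_grading (@gres_diff_deg _ _ _ _ Q) i.
apply: (degree_reflect grP) => //.
- exact: (grading_span grQ).
- exact: (grading0 grQ).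
- exact: (gradingD grQ).
- exact: bij_inj.
move=> sigma _ [z zD ->].
have h : sb_set (gr_cocycles (@gres_diff _ _ _ _ P) i) (fun x => sub_val z (f i x)).
  exact: (precomp_cocycle (H := fun X => @gr_hom k G A X) Hpre fgs (sub_valP z)).
rewrite (FE z h); exists (sub_mk h) => //.
by apply: hom_deg_precomp zD; apply: (he_morf fgs).
Qed.

Definition forget_resolution (M : grmod E) (P : gr_resolution M) : resolution M :=
  Resolution (res_mod := fun n => P n) (@gres_aug_surj _ _ _ _ P)
    (@gres_exact0 _ _ _ _ P) (@gres_exactS _ _ _ _ P).

(** The two complexes of functionals are equal. *)
Lemma fg_gr_Ext (M : grmod E) (P : gr_resolution M) (i : nat) :
  (forall n, finitely_generated (P n)) ->
  bimod_iso (gr_Ext P i) (Ext (forget_resolution P) i).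
Proof.
move=> Pfg.
have [||||||||||F [FI _]] := @subquot_iso k A _ _
  (gr_cocycles (@gres_diff _ _ _ _ P) i) (gr_coboundaries (@gres_diff _ _ _ _ P) i)
  (cocycles (fun n => @gres_diff _ _ _ _ P n) i)
  (coboundaries (fun n => @gres_diff _ _ _ _ P n) i) id id => //.
- by move=> z [zH zd]; split=> //; apply: gr_hom_is_hom.
- case: i => [|i] //= z [g gH ->]; exists g => //.
  exact: gr_hom_is_hom.
- by move=> z [zH zd]; split=> //; apply: fg_gr_hom.
- case: i => [|i] //= z [g gH ->]; exists g => //.
  exact: fg_gr_hom.
- by move=> z _; rewrite subrr; apply: sb0.
- by move=> z _; rewrite subrr; apply: sb0.
by exists F.
Qed.
End ExtIndependence.

(** * The equivalence *)

Section Smoothness.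
Variables (k : fieldType) (G : zmodType) (A : graded_kalgebra k G).

Lemma smooth_gr_smooth : homologically_smooth A -> gr_homologically_smooth A.
Proof.
move=> [P [Pf [n P0]]].
have AP := resolution_fp_dim Pf P0.
have zf : fgp ('rV[env A]_0 : lmodType (env A)).
  by split; [apply: free_projective|apply: free_fg].
exact: (fp_dim_gr_resolution (env_grading A) (@env_degM k G A)
  (M := gr_env_mod (gr_regular_bimod A)) zf (fp_dim_prod zf AP)).
Qed.

Lemma gr_smooth_smooth : gr_homologically_smooth A -> homologically_smooth A.
Proof.
move=> [P [Pf Pl]]; exists (forget_resolution P); split=> // i.
have [Pp Pfg] := Pf i; split=> //.
by apply: (gr_projective_projective (env_grading A) (@env_degM k G A)).
Qed.
End Smoothness.

Theorem theorem1p3 (k : fieldType) (G : zmodType) (A : graded_kalgebra k G)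
    (d : nat) :
  twisted_CY A d <-> gr_twisted_CY A d.
Proof.
split=> [[As [U [Uinv UExt]]]|[As [U [Uinv UExt]]]].
- have As' := smooth_gr_smooth As; split=> //.
  have [P [Pf _]] := As'.
  have Pp i := (Pf i).1; have Pfg i := (Pf i).2.
  have Pp' i : projective (P i).
    by apply: (gr_projective_projective (env_grading A) (@env_degM k G A)).
  have [P0 PU] := UExt (forget_resolution P) Pp'.
  (* [U] carries no grading; the graded Ext, isomorphic to it, does *)
  exists (gr_cohomology_grbimod (@gres_diff_deg _ _ _ _ P) d); split.
    apply: invertible_gr_invertible; apply: invertible_iso Uinv.
    by apply: bimod_iso_trans PU; apply: fg_gr_Ext.
  move=> Q Qp; split; last exact: gr_Ext_iso.
  move=> i /P0; apply: bimod_iso_zero.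
  apply: (@bimod_iso_trans _ _ _ (gr_Ext P i)).
    by apply: bimod_iso_sym; apply: fg_gr_Ext.
  by have [F [FI _]] := gr_Ext_iso i Qp Pp; exists F.
- split; first exact: gr_smooth_smooth.
  exists U; split; first exact: gr_invertible_invertible.
  have [P [Pf _]] := As.
  have Pp i := (Pf i).1; have Pfg i := (Pf i).2.
  have Pp' i : projective (forget_resolution P i).
    by apply: (gr_projective_projective (env_grading A) (@env_degM k G A)).
  have [P0 [F [FI _]]] := UExt P Pp.
  move=> Q Qp; split=> [i /P0|].
    apply: bimod_iso_zero; apply: bimod_iso_trans (Ext_iso i Qp Pp').
    exact: fg_gr_Ext.
  apply: (bimod_iso_trans (Ext_iso d Pp' Qp)).
  apply: (@bimod_iso_trans _ _ _ (gr_Ext P d)); last by exists F.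
  by apply: bimod_iso_sym; apply: fg_gr_Ext.
Qed.
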